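(* Consider the stochastic program $\min_{x\in X}\mathbb{E}[f(x,\tilde\xi)]$ and the sequential sampling procedure with sampling method $s\in\{\mathcal{A},\mathcal{L}\}$ (antithetic variates, Latin hypercube sampling) and assessment procedure $a\in\{S,A\}$ (SRP, A2RP), as defined in the context. Suppose: (A$_{\text{SP}}$) (i) $f(\cdot,\tilde\xi)$ is continuous on $X$ with probability one; (ii) there is a positive real number $C$ with $\sup_{x\in X,\xi\in\Xi}|f(x,\xi)|\le C$; (iii) $X\neq\emptyset$ and $X$ is compact; (iv) the components of $\tilde\xi$ are independent, with (analytically or numerically) invertible cumulative distribution functions. (A1) The sequence of candidate solutions $\{x_k\}$ has at least one limit point in $X^*$, with probability one. For $s=\mathcal{L}$, additionally suppose: (A2) For all $\theta\in\mathbb{R}$, $x\in X$ and $n\ge 2$, $\Phi_{\mathcal{L},n}(x,\theta)\le\Phi_{\mathcal{I},n}(x,\theta)$, where $$\Phi_{\mathcal{L},n}(x,\theta)=\mathbb{E}\Big[\exp\Big(\theta\sum_{i=1}^n\big(f(x,\tilde\xi^i_{\mathcal{L}})-\mathbb{E}[f(x,\tilde\xi)]\big)\Big)\Big],\qquad \Phi_{\mathcal{I},n}(x,\theta)=\Big(\mathbb{E}\Big[\exp\Big(\theta\big(f(x,\tilde\xi)-\mathbb{E}[f(x,\tilde\xi)]\big)\Big)\Big]\Big)^n,$$ and $\{\tilde\xi^1_{\mathcal{L}},\dots,\tilde\xi^n_{\mathcal{L}}\}$ is a Latin hypercube sample of size $n$. Let $\varepsilon>\varepsilon'>0$, $h'>0$,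 $p>0$ and $0<\alpha<1$ be fixed. For each $h>h'$, let the sample sizes $n_k$, $k\ge1$, satisfy $$n_k\ \ge\ \Big(\frac{1}{h-h'}\Big)^2\big(c_p+2p\ln^2 k\big)\ \text{ if } s=\mathcal{L},\qquad \frac{n_k}{2}\ \ge\ \Big(\frac{1}{h-h'}\Big)^2\big(c_p+2p\ln^2 k\big)\ \text{ if } s=\mathcal{A},$$ where $c_p=\max\Big\{2\ln\Big(\sum_{j=1}^{\infty}j^{-p\ln j}\big/(\sqrt{2\pi}\,\alpha)\Big),\,1\Big\}$, with $n_k$ even if $(s,a)=(\mathcal{L},A)$ or $(\mathcal{A},S)$, and $n_k$ a multiple of $4$ if $(s,a)=(\mathcal{A},A)$. Let $$T=\inf_{k\ge1}\Big\{k:\ \texttt{GAP}^a_{s,n_k}(x_k)\le h'\sqrt{\texttt{SV}^a_{s,n_k}(x_k)}+\varepsilon'\Big\}.$$ Then for all $(s,a)=(\mathcal{A},S),(\mathcal{A},A),(\mathcal{L},S),(\mathcal{L},A)$: (i) $\mathbb{P}(T<\infty)=1$; (ii) $\displaystyle\liminf_{h\downarrow h'}\ \mathbb{P}\Big\{\mathcal{G}_{x_T}\le h\sqrt{\texttt{SV}^a_{s,n_T}(x_T)}+\varepsilon\Big\}\ \ge\ 1-\alpha.$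
   Context: **Problem.** $X\subseteq\mathbb{R}^{d_x}$; $\tilde\xi$ is a random vector with distribution $P$ (not depending on $x$) and support $\Xi\subseteq\mathbb{R}^{d_\xi}$; $f:X\times\Xi\to\mathbb{R}$ is Borel measurable. $z^*=\min_{x\in X}\mathbb{E}[f(x,\tilde\xi)]$ is the optimal value and $X^*=\operatorname{argmin}_{x\in X}\mathbb{E}[f(x,\tilde\xi)]$ the set of optimal solutions. For $x\in X$ the optimality gap is $\mathcal{G}_x=\mathbb{E}[f(x,\tilde\xi)]-z^*\ge 0$. $F_j^{-1}$ denotes the inverse of the cumulative distribution function of the $j$-th component of $\tilde\xi$. **Antithetic variates (AV, $s=\mathcal{A}$).** An AV pair $(\tilde\xi_{\mathcal{A}},\tilde\xi_{\mathcal{A}'})$ is obtained by drawing $\tilde u$ uniformly on $(0,1)^{d_\xi}$ and applying the inverse transforms $F_j^{-1}$ componentwise to $\tilde u$ and to $\vec 1-\tilde u$ ($\vec 1$ is the vector of ones). Distinct AV pairs are i.i.d. A sample of (even) size $n$ consists of $n/2$ AV pairs. Put $g_{\mathcal{A}}(x,\tilde\xi)=\tfrac12\big(f(x,\tilde\xi_{\mathcal{A}})+f(x,\tilde\xi_{\mathcal{A}'})\big)$, and $g_{\mathcal{A}}(x,\tilde\xi^i)$ for its value at the $i$-th pair. **Latin hypercube sampling (LHS, $s=\mathcal{L}$).** An LHS sample $\{\tilde\xi^1_{\mathcal{L}},\dots,\tilde\xi^n_{\mathcal{L}}\}$ of size $n$ is formed as follows, independently for each dimension $j=1,\dots,d_\xi$: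 draw independent $\tilde u^i_j\sim U(\frac{i-1}{n},\frac in)$, $i=1,\dots,n$; draw an independent uniformly random permutation $(\pi^1_j,\dots,\pi^n_j)$ of $\{1,\dots,n\}$; set $\tilde\xi^i_{\mathcal{L},j}=F_j^{-1}\big(\tilde u_j^{\pi^i_j}\big)$. **Single Replication Procedure (SRP, $a=S$).** For $x\in X$ and a sample of size $n$: - LHS: let $x^*_{\mathcal{L},n}$ be an optimal solution of $\min_{y\in X}\frac1n\sum_{i=1}^n f(y,\tilde\xi^i_{\mathcal{L}})$ and $$\texttt{GAP}^S_{\mathcal{L},n}(x)=\frac1n\sum_{i=1}^n\big(f(x,\tilde\xi^i_{\mathcal{L}})-f(x^*_{\mathcal{L},n},\tilde\xi^i_{\mathcal{L}})\big),$$ $$\texttt{SV}^S_{\mathcal{L},n}(x)=\frac1{n-1}\sum_{i=1}^n\Big[\big(f(x,\tilde\xi^i_{\mathcal{L}})-f(x^*_{\mathcal{L},n},\tilde\xi^i_{\mathcal{L}})\big)-\texttt{GAP}^S_{\mathcal{L},n}(x)\Big]^2.$$ - AV: let $x^*_{\mathcal{A},n}$ be an optimal solution of $\min_{y\in X}\frac2n\sum_{i=1}^{n/2}g_{\mathcal{A}}(y,\tilde\xi^i)$ and $$\texttt{GAP}^S_{\mathcal{A},n}(x)=\frac{1}{n/2}\sum_{i=1}^{n/2}\big[g_{\mathcal{A}}(x,\tilde\xi^i)-g_{\mathcal{A}}(x^*_{\mathcal{A},n},\tilde\xi^i)\big],$$ $$\texttt{SV}^S_{\mathcal{A},n}(x)=\frac{1}{n/2-1}\sum_{i=1}^{n/2}\Big[\big(g_{\mathcal{A}}(x,\tilde\xi^i)-g_{\mathcal{A}}(x^*_{\mathcal{A},n},\tilde\xi^i)\big)-\texttt{GAP}^S_{\mathcal{A},n}(x)\Big]^2.$$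 **Averaged Two-Replication Procedure (A2RP, $a=A$).** With two independent samples of size $n/2$ each (by the same method $s$), giving SRP estimators indexed $1$ and $2$, $$\texttt{GAP}^A_{s,n}(x)=\tfrac12\big(\texttt{GAP}^{S,1}_{s,n/2}(x)+\texttt{GAP}^{S,2}_{s,n/2}(x)\big),\qquad \texttt{SV}^A_{s,n}(x)=\tfrac12\big(\texttt{SV}^{S,1}_{s,n/2}(x)+\texttt{SV}^{S,2}_{s,n/2}(x)\big).$$ **Sequential sampling procedure.** A sequence of (random) candidate solutions $x_1,x_2,\ldots\in X$ is given, generated by any method. A pair $(s,a)$ is fixed. Parameters satisfy $h>h'>0$, $\varepsilon>\varepsilon'>0$, $\alpha\in(0,1)$. At iteration $k=1,2,\dots$, a sample of size $n_k$ ($n_k\ge n_{k-1}$, $n_0=2$) is generated by method $s$ and $\texttt{GAP}^a_{s,n_k}(x_k)$, $\texttt{SV}^a_{s,n_k}(x_k)$ are computed from it. The samples used to assess solution quality are independent of those used to generate the candidate solutions. For LHS a completely new, independent sample is generated at each iteration; for AV one may either append new independent AV pairs to the previous ones or generate entirely new ones. The procedure stops at the iteration $T$ in the claim and outputs $x_T$. Sample sizes are always large enough for the estimators to be defined. The sample sizes $n_k$, and hence $T$, depend on $h$; in (ii), $h'$ is fixed and $h$ decreases to $h'$. *)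

(* Defs.v *)
From HB Require Import structures.
From mathcomp Require Import all_boot all_order all_algebra perm.
From mathcomp Require Import all_classical all_reals all_analysis.
From mathcomp Require Import measurable_realfun.

Set Implicit Arguments.
Unset Strict Implicit.
Unset Printing Implicit Defensive.

Import Order.TTheory GRing.Theory Num.Theory.
Import numFieldNormedType.Exports.

Local Open Scope classical_set_scope.
Local Open Scope ring_scope.

(* Matrices carry the Borel sigma-algebra of their norm topology. *)
HB.instance Definition _ (R : realType) (m n : nat) :=
  @isMeasurable.Build (sigma_display (@open 'M[R]_(m, n))) 'M[R]_(m, n)
    <<s (@open 'M[R]_(m, n)) >> (@sigma_algebra0 _ setT _)
    (@sigma_algebraC 'M[R]_(m, n) _) (@sigma_algebra_bigcup _ setT _).

Definition coord (R : realType) (d : nat) (j : 'I_d) (v : 'rV[R]_d) : R :=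
  v ord0 j.

Lemma measurable_coord (R : realType) (d : nat) (j : 'I_d) :
  measurable_fun setT (@coord R d j).
Proof.
apply: (measurability _ (RGenOpens.measurableE R)) => _ [_ [a [b ->]] <-].
rewrite setTI; apply: sub_sigma_algebra; apply: open_comp.
  by move=> v _; exact: coord_continuous.
exact: itv_open.
Qed.

HB.instance Definition _ (R : realType) (d : nat) (j : 'I_d) :=
  isMeasurableFun.Build _ _ _ _ (@coord R d j) (@measurable_coord R d j).

Section independence.
Context d (Omega : measurableType d) (R : realType) (P : probability Omega R).

Definition mutual_indep (I : eqType) (D : set I)
    (G : I -> set (set Omega)) : Prop :=
  forall (s : seq I) (A : I -> set Omega),
    uniq s -> (forall i, i \in s -> D i) -> (forall i, i \in s -> G i (A i)) ->
    P (\bigcap_(i in [set` s]) A i) = (\prod_(i <- s) P (A i))%E.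

Definition sigma_rvs (I : Type) (D : set I) d' (S : measurableType d')
    (Y : I -> Omega -> S) : set (set Omega) :=
  <<s \bigcup_(i in D) preimage_set_system setT (Y i) measurable >>.

(* The open range is imposed surely, not just almost surely, so that inverse
   transforms of uniform variables always lie in the support. *)
Definition uniform_rv (a b : R) (Y : Omega -> R) : Prop :=
  [/\ measurable_fun setT Y, forall w, a < Y w < b
    & exists ab : a < b, forall A : set R, measurable A ->
        P (Y @^-1` A) = uniform_prob ab A].

Definition uniform_cube (n : nat) (u : Omega -> 'rV[R]_n) : Prop :=
  [/\ measurable_fun setT u,
      forall j, uniform_rv 0 1 (coord j \o u)
    & mutual_indep setT (fun j : 'I_n =>
        preimage_set_system setT (coord j \o u) measurable)].

Definition uniform_perm (n : nat) (pi : Omega -> 'S_n) : Prop :=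
  forall s, measurable (pi @^-1` [set s]) /\
            P (pi @^-1` [set s]) = ((n`!%:R)^-1)%:E.

End independence.

Section distribution_on_Rd.
Context (R : realType) (d : nat) (mu : probability 'rV[R]_d R).

Definition msupport : set 'rV[R]_d :=
  [set z | forall U, open U -> U z -> (0 < mu U)%E].

Definition marginal_cdf (j : 'I_d) (t : R) : R :=
  fine (cdf (coord j : {RV mu >-> R}) t).

(* The plateaus at 0 and 1 are discarded, so that e.g. exponential and
   uniform laws are covered. *)
Definition cdf_dom (j : 'I_d) : set R := [set t | 0 < marginal_cdf j t < 1].

Definition invertible_cdf (j : 'I_d) : Prop :=
  set_bij (cdf_dom j) `]0, 1[ (marginal_cdf j).

Definition inv_cdf (j : 'I_d) : R -> R :=
  'pinv_(fun=> 0) (cdf_dom j) (marginal_cdf j).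

Definition inv_transform (u : 'rV[R]_d) : 'rV[R]_d :=
  \row_j inv_cdf j (coord j u).

Definition indep_components : Prop :=
  mutual_indep mu setT (fun j : 'I_d =>
    preimage_set_system setT (coord j) measurable).

End distribution_on_Rd.

Section stochastic_program.
Context (R : realType) (dx dxi : nat).
Context (X : set 'rV[R]_dx) (f : 'rV[R]_dx -> 'rV[R]_dxi -> R).
Context (mu : probability 'rV[R]_dxi R).

(* f x z is meaningful for z in the support only, hence the restricted
   domain of integration; the support has full measure. *)
Definition Ef (x : 'rV[R]_dx) : R := \int[mu]_(z in msupport mu) f x z.

Definition zstar : R := inf [set Ef x | x in X].

Definition Xstar : set 'rV[R]_dx :=
  [set x | X x /\ forall y, X y -> Ef x <= Ef y].

Definition opt_gap (x : 'rV[R]_dx) : R := Ef x - zstar.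

Definition A_SP : Prop :=
  [/\ {ae mu, forall z, {within X, continuous (f^~ z)}},
      exists C : R, 0 < C /\
        forall x z, X x -> msupport mu z -> `|f x z| <= C,
      X !=set0 /\ compact X
    & indep_components mu /\ forall j, invertible_cdf mu j].

End stochastic_program.

Variant method := Antithetic | LatinHypercube.
Variant assessment := SRP | A2RP.

(* A sample is a sequence of points of which only the first n matter; for
   antithetic variates the points 2i and 2i+1 form the i-th pair. *)
Definition points_per_obs (s : method) : nat := if s is Antithetic then 2 else 1.

Definition nrep (a : assessment) : nat := if a is A2RP then 2 else 1.

Definition rep_size (a : assessment) (n : nat) : nat := (n %/ nrep a)%N.

Definition nobs (s : method) (a : assessment) (n : nat) : nat :=
  (rep_size a n %/ points_per_obs s)%N.

Section estimators.
Context (R : realType) (dx dxi : nat).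
Context (f : 'rV[R]_dx -> 'rV[R]_dxi -> R).

Definition obs (s : method) (pts : nat -> 'rV[R]_dxi) (i : nat)
    (y : 'rV[R]_dx) : R :=
  match s with
  | LatinHypercube => f y (pts i)
  | Antithetic => 2^-1 * (f y (pts i.*2) + f y (pts i.*2.+1))
  end.

Context (m : nat) (phi : nat -> 'rV[R]_dx -> R).

Definition sample_avg (y : 'rV[R]_dx) : R := m%:R^-1 * \sum_(i < m) phi i y.

Definition srp_gap (x xopt : 'rV[R]_dx) : R :=
  m%:R^-1 * \sum_(i < m) (phi i x - phi i xopt).

Definition srp_sv (x xopt : 'rV[R]_dx) : R :=
  (m%:R - 1)^-1 *
  \sum_(i < m) ((phi i x - phi i xopt) - srp_gap x xopt) ^+ 2.

End estimators.

Section gap_sv.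
Context (R : realType) (dx dxi : nat).
Context (f : 'rV[R]_dx -> 'rV[R]_dxi -> R) (s : method) (a : assessment).
Context (n : nat) (pts : 'I_(nrep a) -> nat -> 'rV[R]_dxi).
Context (x : 'rV[R]_dx) (xopt : 'I_(nrep a) -> 'rV[R]_dx).

Definition GAP : R := (nrep a)%:R^-1 *
  \sum_(r < nrep a) srp_gap (nobs s a n) (obs f s (pts r)) x (xopt r).

Definition SV : R := (nrep a)%:R^-1 *
  \sum_(r < nrep a) srp_sv (nobs s a n) (obs f s (pts r)) x (xopt r).

End gap_sv.

Section sampling.
Context d (Omega : measurableType d) (R : realType) (P : probability Omega R).
Context (dx dxi : nat) (mu : probability 'rV[R]_dxi R).

Definition lhs_sample (n : nat) (xi : nat -> Omega -> 'rV[R]_dxi) : Prop :=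
  exists (u : 'I_dxi -> 'I_n -> Omega -> R) (pi : 'I_dxi -> Omega -> 'S_n),
  [/\ forall j (i : 'I_n), uniform_rv P (i%:R / n%:R) (i.+1%:R / n%:R) (u j i),
      forall j, uniform_perm P (pi j),
      mutual_indep P setT (fun t : 'I_dxi * option 'I_n =>
        match t.2 with
        | Some i => preimage_set_system setT (u t.1 i) measurable
        | None => preimage_set_system setT (pi t.1) setT
        end)
    & forall (i : 'I_n) w,
        xi i w = \row_j inv_cdf mu j (u j (pi j w i) w)].

(* At iteration k >= 2 either the pairs of iteration k-1 are kept and new
   ones appended, or (fresh k) all pairs are new; iteration k uses the pairs
   av_start k, ..., av_start k + m k - 1 of an i.i.d. stream of pairs. *)
Fixpoint av_start (fresh : nat -> bool) (m : nat -> nat) (k : nat) : nat :=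
  if k is k'.+1 then
    if (0 < k')%N && fresh k then (av_start fresh m k' + m k')%N
    else av_start fresh m k'
  else 0%N.

Definition sampling (s : method) (a : assessment) (n : nat -> nat)
    (x : nat -> Omega -> 'rV[R]_dx)
    (xi : nat -> 'I_(nrep a) -> nat -> Omega -> 'rV[R]_dxi) : Prop :=
  let candidates := sigma_rvs [set k | (0 < k)%N] x in
  match s with
  | LatinHypercube =>
      (forall k r, (0 < k)%N -> lhs_sample (rep_size a (n k)) (xi k r)) /\
      mutual_indep P
        [set t : option (nat * 'I_(nrep a)) | if t is Some kr then (0 < kr.1)%N
                                              else True]
        (fun t => if t is Some kr
          then sigma_rvs `I_(rep_size a (n kr.1)) (xi kr.1 kr.2)
          else candidates)
  | Antithetic =>
      exists (u : 'I_(nrep a) -> nat -> Omega -> 'rV[R]_dxi)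
             (fresh : nat -> bool),
      [/\ forall r i, uniform_cube P (u r i),
          mutual_indep P setT (fun t : option ('I_(nrep a) * nat) =>
            if t is Some ri
            then preimage_set_system setT (u ri.1 ri.2) measurable
            else candidates)
        & forall k r i w, (0 < k)%N -> (i < nobs Antithetic a (n k))%N ->
            let v := u r (av_start fresh (fun l => nobs Antithetic a (n l)) k + i)%N w in
            xi k r i.*2 w = inv_transform mu v /\
            xi k r i.*2.+1 w = inv_transform mu (const_mx 1 - v)]
  end.

Context (f : 'rV[R]_dx -> 'rV[R]_dxi -> R).

Definition Phi_L (n : nat) (xi : nat -> Omega -> 'rV[R]_dxi)
    (x : 'rV[R]_dx) (theta : R) : \bar R :=
  'E_P[fun w => expR (theta * \sum_(i < n) (f x (xi i w) - Ef f mu x))].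

Definition Phi_I (n : nat) (x : 'rV[R]_dx) (theta : R) : \bar R :=
  ((\int[mu]_(z in msupport mu) (expR (theta * (f x z - Ef f mu x)))%:E) ^+ n)%E.

(* All Latin hypercube samples of size n have the same law, so Phi_L does not
   depend on the choice of xi. *)
Definition A2_LHS (X : set 'rV[R]_dx) : Prop :=
  forall (theta : R) (x : 'rV[R]_dx) (n : nat), X x -> (2 <= n)%N ->
  forall xi, lhs_sample n xi -> (Phi_L n xi x theta <= Phi_I n x theta)%E.

End sampling.

Definition c_p (R : realType) (p alpha : R) : R :=
  Num.max (2 * ln (fine (\sum_(1 <= j <oo) (j%:R `^ (- p * ln j%:R))%:E)%E
                   / (Num.sqrt (2 * pi) * alpha))) 1.

Section stopping.
Context (R : realType) (Omega : Type).

(* First k >= 1 at which the rule holds, +oo if there is none. *)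
Definition stopping_time (h' eps' : R) (gap sv : nat -> Omega -> R)
    (w : Omega) : \bar R :=
  ereal_inf [set k%:R%:E | k in
    [set k : nat | (0 < k)%N /\ gap k w <= h' * Num.sqrt (sv k w) + eps']].

End stopping.

(* Main.v *)
Require Import Defs.
From HB Require Import structures.
From mathcomp Require Import all_boot all_order all_algebra.
From mathcomp Require Import all_classical all_reals all_analysis.
From mathcomp Require Import measurable_realfun lra ring perm.
From mathcomp Require finmap.

Set Implicit Arguments.
Unset Strict Implicit.
Unset Printing Implicit Defensive.

Import Order.TTheory GRing.Theory Num.Theory.
Import numFieldNormedType.Exports.
Import Defs.

Local Open Scope classical_set_scope.
Local Open Scope ring_scope.

(** The two tolerances are separated, [eps' < eps], and [f] is bounded; so both
    claims follow from large deviation bounds, without any limit law.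

    Claim (ii).  When the procedure stops at [k] while the optimality gap of the
    candidate exceeds its bound, the estimated gap is smaller than the true gap
    by more than [eps - eps'].  The estimate is at least the difference between
    the sample averages at [x k] and at a fixed optimal solution, because the
    sample minimiser does at least as well as the latter.  Hence, in one of
    the replications, one of these two averages deviates from its mean by
    [(eps - eps') / 2], an event of probability [O(exp(- b m))] for a sample of
    [m] observations.  The sample sizes are at least
    [(h - h')^-2 (1 + 2 p ln^2 k)] up to a factor, so these bounds are summable
    over [k] and the sum vanishes as [h] decreases to [h'] ([exp_log_sq_bound],
    [coverage]).

    Claim (i).  Let [k] be the first index beyond a large [K] for which the
    candidate is nearly optimal; it exists almost surely as the candidates have
    an optimal limit point.  This index depends on the candidates only, which
    are independent of the samples, so the sample drawn at this random iteration
    is as good as one drawn at a fixed iteration: its averages are uniformly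
    close to their means with probability near 1, and then the rule stops the
    procedure ([random_index], [uniform_deviation], [not_stopped_le]).

    Exponential tails are first proved at a fixed [x].  For antithetic variates
    the pairs are independent and Chernoff's bound applies to them
    ([chernoff_indep]); for Latin hypercubes the hypothesis on moment generating
    functions reduces the bound to the independent case ([lhs_regular]).  To
    treat random candidates and to get uniformity in [x], the feasible set is
    discretised.  Almost all sections [f^~ z] are uniformly continuous on the
    compact feasible set, so they share a modulus of continuity when [z] is
    confined to a set [E] of measure close to 1
    ([equicontinuous_on_large_set]); by Markov's inequality few sample points
    fall outside [E], and this only requires the points to have law [mu]
    ([outside_tail]).  That the points of both methods do have law [mu] is the
    inverse transform theorem ([law_inv_transform]), applied to antithetic
    uniforms and to stratified uniforms ([stratified_prod]).

    All the events that occur are bounded jointly with an event of the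
    candidates; together with the discretisation this replaces the use of
    Fubini's theorem on the joint law of candidates and samples. *)

(** * Borel sets of row vectors *)

Section borel_rV.
Context (R : realType) (n : nat).

Definition rat_box (c : 'rV[rat]_n * nat) : set 'rV[R]_n :=
  [set z | forall j, ball (ratr (c.1 ord0 j) : R) (c.2.+1%:R^-1) (z ord0 j)].

(** Second countability: this reduces measurability of a vector to that of its
    coordinates.  The boxes that are not contained in [U] are replaced by the
    empty set, so that the index ranges over a countable type. *)
Lemma open_bigcup_rat_box (U : set 'rV[R]_n) : open U ->
  U = \bigcup_(c in [set: 'rV[rat]_n * nat])
        (if `[< rat_box c `<=` U >] then rat_box c else set0).
Proof.
move=> oU; apply/seteqP; split=> [z Uz|z [c _]]; last first.
  by case: asboolP => // cU /cU.
have [e e0 zeU] : exists2 e : R, 0 < e & ball z e `<=` U.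
  by apply/nbhs_ballP; exact: open_nbhs_nbhs.
have [k ke] : exists k : nat, (k.+1%:R^-1 : R) * 2 < e.
  have [k _ /(_ k (leqnn k)) ke] :=
    near_infty_natSinv_lt (PosNum (divr_gt0 e0 (ltr0Sn R 1))).
  by exists k; rewrite -ltr_pdivlMr.
have hq (j : 'I_n) : exists q : rat,
    ratr q \in `]z ord0 j - k.+1%:R^-1, z ord0 j + k.+1%:R^-1[.
  by apply: rat_in_itvoo; rewrite ltrBlDr -addrA ltrDl addr_gt0.
have [q qz] := choice hq.
exists (\row_j q j, k) => //=; case: asboolP => [_|]; last first.
  case=> y /= yq; apply: zeU; split => // i j.
  have -> : i = ord0 by exact: ord1.
  have := yq j; have := qz j; rewrite mxE in_itv/= /ball/=.
  move: ke; rewrite !ltr_norml.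
  move: (k.+1%:R^-1 : R) => a ? /andP[? ?] /andP[? ?].
  by apply/andP; split; lra.
move=> j /=; have := qz j; rewrite mxE in_itv/= /ball/= ltr_norml.
move: (k.+1%:R^-1 : R) => a /andP[? ?].
by apply/andP; split; lra.
Qed.

Lemma measurable_rV d (T : measurableType d) (D : set T) (v : T -> 'rV[R]_n) :
  measurable D ->
  (forall j, measurable_fun D (coord j \o v)) -> measurable_fun D v.
Proof.
move=> mD mv; apply: (measurability (@open 'rV[R]_n)) => // _ [U oU <-].
rewrite (open_bigcup_rat_box oU) preimage_bigcup setI_bigcupr.
apply: countable_bigcupT_measurable => // c.
case: asboolP => _; last by rewrite preimage_set0 setI0.
rewrite (_ : _ `&` _ = D `&` \bigcap_(j in [set: 'I_n])
    (D `&` (coord j \o v) @^-1` (ball (ratr (c.1 ord0 j) : R) c.2.+1%:R^-1))).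
  apply: measurableI => //; apply: fin_bigcap_measurable => // j _.
  by apply: mv => //; apply: open_measurable; exact: ball_open.
apply/seteqP; split => w [Dw wc]; split => // j; first by split=> //; exact: wc.
by have [] := wc j Logic.I.
Qed.

Lemma measurable_fun_rays d (T : measurableType d) (D : set T) (g : T -> R) :
  measurable D -> (forall t, measurable (D `&` [set w | g w <= t])) ->
  measurable_fun D g.
Proof.
move=> mD mg; apply: (measurability _ (RGenOInfty.measurableE R)) => _ [_ [t ->] <-].
rewrite (_ : _ `&` _ = D `\` (D `&` [set w | g w <= t])).
  exact: measurableD.
apply/seteqP; split => w [Dw] /=; rewrite in_itv/= andbT => gt.
  by split=> // -[_]; rewrite leNgt gt.
by split=> //; rewrite ltNge; apply/negP => ?; apply: gt.
Qed.

Lemma measurable_superlevel d (T : measurableType d) (g : T -> R) (c : R) :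
  measurable_fun setT g -> measurable [set w | c <= g w].
Proof.
move=> mg; rewrite (_ : mkset _ = setT `&` g @^-1` `[c, +oo[%classic).
  by apply: mg => //; exact: measurable_itv.
by rewrite setTI; apply/seteqP; split => w; rewrite /= in_itv/= andbT.
Qed.

Definition lower_orthants : set (set 'rV[R]_n) :=
  [set [set z : 'rV[R]_n | forall j, z ord0 j <= t j] | t in [set: 'I_n -> R]].

Lemma lower_orthants_generate :
  @measurable _ 'rV[R]_n = <<s lower_orthants >>.
Proof.
have sub : lower_orthants `<=` @measurable _ 'rV[R]_n.
  move=> _ [t _ <-].
  rewrite (_ : mkset _ = \bigcap_(j in [set: 'I_n]) (coord j @^-1` `]-oo, t j])).
    apply: fin_bigcap_measurable => // j _; rewrite -[X in measurable X]setTI.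
    exact: measurable_coord.
  apply/seteqP; split => z zt j; first by move=> _; rewrite /= in_itv/=; exact: zt.
  by have := zt j Logic.I; rewrite /= in_itv.
apply/seteqP; split => A; last first.
  by apply: smallest_sub => //; exact: sigma_algebra_measurable.
pose T := g_sigma_algebraType lower_orthants.
have mid : measurable_fun [set: T] (fun z : T => (z : 'rV[R]_n)).
  apply: measurable_rV => // j; apply: measurable_fun_rays => // t.
  (* a coordinate half-space is an increasing union of orthants *)
  rewrite setTI (_ : mkset _ = \bigcup_(k : nat)
    ([set z : 'rV[R]_n | forall i, z ord0 i <= if i == j then t else k%:R])).
    apply: bigcupT_measurable => k; apply: sub_sigma_algebra.
    by exists (fun i => if i == j then t else k%:R).
  apply/seteqP; split => z /=; last by case=> k _ /(_ j); rewrite eqxx.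
  rewrite /coord => zt; exists (Num.truncn (\big[Num.max/0]_i `|z ord0 i|)).+1 => // i.
  case: eqP => [->//|_]; apply: (le_trans (ler_norm _)).
  rewrite (le_trans _ (ltW (Num.Theory.truncnS_gt _)))//; exact: le_bigmax.
by move=> mA; have := mid measurableT A mA; rewrite setTI.
Qed.

(** A law on row vectors is determined by its joint distribution function:
    orthants are stable under intersection, and those with a constant bound [k]
    exhaust the space. *)
Lemma probability_rV_unique (m1 m2 : probability 'rV[R]_n R) :
  (forall A, lower_orthants A -> m1 A = m2 A) -> forall A, measurable A -> m1 A = m2 A.
Proof.
move=> m12 A; rewrite lower_orthants_generate => sA.
apply: (g_sigma_algebra_measure_unique lower_orthants _
  (fun k => [set z : 'rV[R]_n | forall j, z ord0 j <= k%:R])) => //.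
- move=> B oB; rewrite lower_orthants_generate; exact: sub_sigma_algebra.
- by move=> k; exists (fun=> k%:R).
- apply/seteqP; split => // z _.
  exists (Num.truncn (\big[Num.max/0]_i `|z ord0 i|)).+1 => // i.
  rewrite (le_trans (ler_norm _))// (le_trans _ (ltW (Num.Theory.truncnS_gt _)))//.
  exact: le_bigmax.
- move=> _ _ [s _ <-] [t _ <-]; exists (fun j => Num.min (s j) (t j)) => //.
  apply/seteqP; split => z /=.
    by move=> zst; split => j; have := zst j; rewrite le_min => /andP[].
  by move=> [zs zt] j; rewrite le_min zs zt.
- move=> k; apply: (le_lt_trans _ (ltry 1)); apply: probability_le1.
  by rewrite lower_orthants_generate; apply: sub_sigma_algebra; exists (fun=> k%:R).
Qed.

End borel_rV.

(** * Inverse transforms *)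

Section inverse_transform.
Context (R : realType) (n : nat) (mu : probability 'rV[R]_n R).

Lemma marginal_cdfE (j : 'I_n) t :
  (marginal_cdf mu j t)%:E = mu [set z | z ord0 j <= t].
Proof.
by rewrite /marginal_cdf fineK ?fin_num_measure.
Qed.

Lemma measurable_coord_le (j : 'I_n) t : measurable [set z : 'rV[R]_n | z ord0 j <= t].
Proof.
rewrite (_ : mkset _ = coord j @^-1` `]-oo, t]).
  by rewrite -[X in measurable X]setTI; exact: measurable_coord.
by apply/seteqP; split => z; rewrite /= in_itv.
Qed.

Lemma marginal_cdf_mono (j : 'I_n) s t :
  s <= t -> marginal_cdf mu j s <= marginal_cdf mu j t.
Proof.
move=> st; rewrite -lee_fin !marginal_cdfE le_measure ?inE//;
  try exact: measurable_coord_le.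
by move=> z /= /le_trans; apply.
Qed.

Lemma marginal_cdf_01 (j : 'I_n) t : 0 <= marginal_cdf mu j t <= 1.
Proof.
rewrite -!lee_fin marginal_cdfE measure_ge0 probability_le1//.
exact: measurable_coord_le.
Qed.

Hypothesis invF : forall j, invertible_cdf mu j.

Lemma inv_cdf_dom j u : 0 < u < 1 -> cdf_dom mu j (inv_cdf mu j u).
Proof.
have [_ _ surjF] := invF j => u01.
by apply: (surjpinv_image_sub surjF); exists u => //; rewrite /= in_itv.
Qed.

Lemma marginal_inv_cdf j u : 0 < u < 1 -> marginal_cdf mu j (inv_cdf mu j u) = u.
Proof.
have [_ _ surjF] := invF j => u01.
by rewrite /inv_cdf (surjpK _ surjF)// inE /= in_itv.
Qed.

(** Galois connection.  Where the distribution function is 0 or 1, outside the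
    domain of its inverse, both sides are decided by [0 < u < 1]; inside, it
    follows from injectivity. *)
Lemma inv_cdf_le j u t : 0 < u < 1 ->
  (inv_cdf mu j u <= t) = (u <= marginal_cdf mu j t).
Proof.
move=> u01; apply/idP/idP => [ut|].
  by rewrite -{1}(marginal_inv_cdf j u01); exact: marginal_cdf_mono.
apply: contraTT; rewrite -!ltNge => tu.
have := marginal_cdf_mono j (ltW tu).
rewrite marginal_inv_cdf// le_eqVlt => /orP[/eqP Ft|//].
have [_ injF _] := invF j.
suff tE : t = inv_cdf mu j u by rewrite tE ltxx in tu.
apply: (injF t (inv_cdf mu j u)); rewrite ?inE ?marginal_inv_cdf//.
  by rewrite /cdf_dom/= Ft.
exact: inv_cdf_dom.
Qed.

Definition cube : set 'rV[R]_n := [set v | forall j, 0 < v ord0 j < 1].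

Lemma measurable_cube : measurable cube.
Proof.
rewrite (_ : cube = \bigcap_(j in [set: 'I_n]) (coord j @^-1` `]0, 1[)).
  apply: fin_bigcap_measurable => // j _; rewrite -[X in measurable X]setTI.
  exact: measurable_coord.
apply/seteqP; split => z zt j; first by move=> _; rewrite /= in_itv/=; exact: zt.
by have := zt j Logic.I; rewrite /= in_itv.
Qed.

Lemma inv_transform_le v t : cube v ->
  (forall j, inv_transform mu v ord0 j <= t j) <->
  (forall j, v ord0 j <= marginal_cdf mu j (t j)).
Proof.
by move=> cv; split => + j => /(_ j); rewrite mxE /coord inv_cdf_le.
Qed.

Lemma measurable_inv_transform : measurable_fun cube (inv_transform mu).
Proof.
apply: measurable_rV; first exact: measurable_cube.
move=> j; apply: measurable_fun_rays; first exact: measurable_cube.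
move=> t; rewrite (_ : _ `&` _ = cube `&` [set z | z ord0 j <= marginal_cdf mu j t]).
  by apply: measurableI; [exact: measurable_cube|exact: measurable_coord_le].
by apply/seteqP; split => v [cv] /=; rewrite /coord mxE (inv_cdf_le _ _ (cv j)).
Qed.

Hypothesis indep : indep_components mu.

Lemma lower_orthant_measure (t : 'I_n -> R) :
  mu [set z | forall j, z ord0 j <= t j] = (\prod_j (marginal_cdf mu j (t j))%:E)%E.
Proof.
transitivity (mu (\bigcap_(j in [set` enum 'I_n]) [set z | z ord0 j <= t j])).
  congr (mu _); apply/seteqP; split => z /= zt j; first by move=> _; exact: zt.
  by apply: zt => /=; rewrite mem_enum.
rewrite (indep (enum_uniq _))//.
  by rewrite big_enum/=; apply: eq_bigr => j _; rewrite marginal_cdfE.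
move=> j _; exists `]-oo, t j]%classic; first exact: measurable_itv.
by rewrite setTI; apply/seteqP; split => z; rewrite /= in_itv.
Qed.

(** A marginal distribution function is strictly increasing on its domain, so
    every interval [`]t, z j]] ending at a value [z j] of the inverse has positive
    mass; by independence so does a product of such intervals, and small ones
    fit in any neighbourhood of [z]. *)
Lemma inv_transform_support v : cube v -> msupport mu (inv_transform mu v).
Proof.
move=> cv U oU Uz; set z := inv_transform mu v in Uz.
have [e e0 zeU] : exists2 e : R, 0 < e & ball z e `<=` U.
  by apply/nbhs_ballP; exact: open_nbhs_nbhs.
have ht (j : 'I_n) : exists t : R, [/\ z ord0 j - e < t, t < z ord0 j
    & marginal_cdf mu j t < marginal_cdf mu j (z ord0 j)].
  have v01 := cv j; have zjE : z ord0 j = inv_cdf mu j (v ord0 j) by rewrite mxE.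
  set s := inv_cdf mu j (v ord0 j / 2).
  have v201 : 0 < v ord0 j / 2 < 1 by lra.
  set t := Num.max s (z ord0 j - e / 2).
  have sz : s < z ord0 j.
    rewrite ltNge; apply/negP => /(marginal_cdf_mono j).
    by rewrite zjE !marginal_inv_cdf//; lra.
  have tz : t < z ord0 j by rewrite gt_max sz/=; lra.
  exists t; split => //; first by rewrite lt_max; apply/orP; right; lra.
  rewrite lt_neqAle marginal_cdf_mono ?ltW// andbT; apply/eqP => Ftz.
  have [_ injF _] := invF j.
  suff tE : t = z ord0 j by rewrite tE ltxx in tz.
  have zdom : cdf_dom mu j (z ord0 j) by rewrite zjE; exact: inv_cdf_dom.
  by apply: (injF t (z ord0 j)); rewrite ?inE// /cdf_dom/= Ftz.
have [t tP] := choice ht.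
pose B := \bigcap_(j in [set` enum 'I_n]) (coord j @^-1` `]t j, z ord0 j]).
have mB j : measurable (coord j @^-1` `]t j, z ord0 j] : set 'rV[R]_n).
  by rewrite -[X in measurable X]setTI; exact: measurable_coord.
apply: (@lt_le_trans _ _ (mu B)); last first.
  apply: le_measure; rewrite ?inE.
  - by apply: fin_bigcap_measurable => //; exact: finite_seq.
  - exact: sub_sigma_algebra.
  - move=> y By; apply: zeU; split => // i j; have -> : i = ord0 by exact: ord1.
    have := By j; rewrite /= mem_enum in_itv/= /ball/= => /(_ isT) /andP[ty yz].
    have [h1 h2 _] := tP j; move: ty yz h1 h2; rewrite /coord ltr_norml.
    by move=> *; apply/andP; split; lra.
rewrite (indep (enum_uniq _))//; last first.
  by move=> j _; exists `]t j, z ord0 j]%classic; [exact: measurable_itv|rewrite setTI].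
elim/big_ind : _ => // [p q|j _]; first exact: mule_gt0.
have [_ _ Ftz] := tP j.
rewrite lt_neqAle measure_ge0 andbT eq_sym; apply/eqP => B0.
suff : (mu ([set y : 'rV[R]_n | (y ord0 j <= t j)%R] `|` coord j @^-1` `]t j, z ord0 j])
    <= (marginal_cdf mu j (t j))%:E)%E; last first.
  rewrite marginal_cdfE -[leRHS]adde0 -B0.
  exact: measureU2 (measurable_coord_le j (t j)) (mB j).
apply/negP; rewrite -ltNge.
apply: (@lt_le_trans _ _ (marginal_cdf mu j (z ord0 j))%:E); first by rewrite lte_fin.
rewrite marginal_cdfE; apply: le_measure; rewrite ?inE.
- exact: measurable_coord_le.
- by apply: measurableU => //; exact: measurable_coord_le.
- move=> y /= yz; rewrite in_itv/= /coord.
  by case: (leP (y ord0 j) (t j)) => ?; [left|right].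
Qed.

(** By the Galois connection the transform lies in the orthant of [t] exactly when
    [v] lies in the orthant of the values of the distribution functions at [t].
    Hence only the joint distribution function of [v] on the unit cube matters,
    and the lemma applies to stratified points as well as to uniform ones. *)
Lemma law_inv_transform d (Omega : measurableType d) (P : probability Omega R)
    (v : Omega -> 'rV[R]_n) :
  measurable_fun setT v -> (forall w, cube (v w)) ->
  (forall t : 'I_n -> R, (forall j, 0 <= t j <= 1) ->
     P [set w | forall j, v w ord0 j <= t j] = (\prod_j (t j)%:E)%E) ->
  forall A, measurable A -> P ((inv_transform mu \o v) @^-1` A) = mu A.
Proof.
move=> mv cv prodv.
have mz : measurable_fun setT (inv_transform mu \o v).
  apply: (measurable_comp measurable_cube) => //; last exact: measurable_inv_transform.
  by move=> _ [w _ <-].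
pose X : {RV P >-> 'rV[R]_n} :=
  MeasurableFun.Pack (MeasurableFun.Class (isMeasurableFun.Build _ _ _ _ _ mz)).
move=> A mA; apply: (@probability_rV_unique _ _ (distribution P X) mu) => //.
move=> _ [t _ <-]; rewrite lower_orthant_measure /distribution/= /pushforward/=.
transitivity (P [set w | forall j, v w ord0 j <= marginal_cdf mu j (t j)]).
  by apply: (congr1 P); apply/seteqP; split => w /=; rewrite inv_transform_le.
by rewrite prodv// => j; exact: marginal_cdf_01.
Qed.

End inverse_transform.

(** * Antithetic pairs *)

Section mirror.
Context (R : realType) (n : nat).

Definition mirror (y : 'rV[R]_n) : 'rV[R]_n := const_mx 1 - y.

Lemma mirror_cube y : cube y -> cube (mirror y).
Proof.
by move=> cy j; rewrite !mxE; have /andP[? ?] := cy j; apply/andP; split; lra.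
Qed.

Lemma measurable_mirror : measurable_fun setT mirror.
Proof.
apply: measurable_rV => // j; rewrite (_ : _ \o _ = fun y => 1 - coord j y).
  by apply: measurable_funB.
by apply/funext => y; rewrite /= /coord !mxE.
Qed.

End mirror.

Section uniform.
Context d (Omega : measurableType d) (R : realType) (P : probability Omega R).

Lemma uniform_rv_itv (a b c e : R) Y A : uniform_rv P a b Y -> measurable A ->
  c <= e -> A `&` `[a, b]%classic = `[c, e]%classic ->
  P (Y @^-1` A) = ((e - c) / (b - a))%:E.
Proof.
move=> [mY rY [ab PY]] mA ce AE; rewrite PY// /uniform_prob integral_uniform_pdf AE.
rewrite (eq_integral (fun=> (b - a)^-1%:E)); last first.
  move=> x; rewrite -AE inE => -[_] /=; rewrite in_itv/= => xab.
  by rewrite /uniform_pdf xab.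
rewrite integral_cst//= lebesgue_measure_itv/= lte_fin.
case: ltP => [_|ec]; first by rewrite -EFinD -EFinM mulrC.
by rewrite mule0 (_ : e = c) ?subrr ?mul0r//; apply/eqP; rewrite eq_le ec ce.
Qed.

Lemma uniform_rv_le (a b t : R) Y : uniform_rv P a b Y ->
  P [set w | Y w <= t] = (Num.min 1 (Num.max 0 ((t - a) / (b - a))))%:E.
Proof.
move=> unifY; have [mY rY [ab _]] := unifY.
have ba0 : 0 < b - a by rewrite subr_gt0.
have setE A : A = [set w | Y w <= t] -> P A = P [set w | Y w <= t] by move->.
have [ta|at_] := ltP t a.
  rewrite max_l; last by rewrite pmulr_lle0 ?invr_gt0// subr_le0 ltW.
  rewrite min_r//; transitivity (P set0); last exact: measure0.
  apply/esym/setE/seteqP; split => // w /= Yt.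
  by have /andP[aY _] := rY w; move: (lt_le_trans aY Yt); rewrite ltNge ltW.
rewrite max_r; last by rewrite divr_ge0 ?subr_ge0// ltW.
have [bt|tb] := leP b t.
  rewrite min_l; last by rewrite ler_pdivlMr// mul1r lerD2r.
  transitivity (P setT); last exact: probability_setT.
  apply/esym/setE/seteqP; split => // w _ /=.
  by have /andP[_ Yb] := rY w; rewrite (le_trans (ltW Yb)).
rewrite min_r; last by rewrite ler_pdivrMr// mul1r lerD2r ltW.
rewrite -(@uniform_rv_itv a b a t Y `]-oo, t]%classic)//.
apply/seteqP; split => x /=; rewrite !in_itv/=; first by move=> [-> /andP[->]].
by move=> /andP[ax xt]; rewrite ax xt (le_trans xt)// ltW.
Qed.

Lemma uniform_rv_ge (t : R) Y : uniform_rv P 0 1 Y -> 0 <= t <= 1 ->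
  P [set w | 1 - Y w <= t] = t%:E.
Proof.
move=> unifY /andP[t0 t1]; have [mY rY [ab _]] := unifY.
transitivity (P (Y @^-1` `[1 - t, +oo[%classic)).
  by apply: (congr1 P); apply/seteqP; split => w;
    rewrite /= in_itv/= andbT lerBlDr lerBlDl.
rewrite (@uniform_rv_itv 0 1 (1 - t) 1)//; last 2 first.
- by lra.
- apply/seteqP; split => x /=; rewrite !in_itv/= ?andbT.
    by move=> [-> /andP[_ ->]].
  by move=> /andP[x1 x2]; rewrite x1 x2; split => //; rewrite andbT; lra.
by congr EFin; rewrite subr0 divr1 subKr.
Qed.

Section antithetic.
Context (n : nat) (u : Omega -> 'rV[R]_n).
Hypothesis cu : uniform_cube P u.

Lemma uniform_cube_cube w : cube (u w).
Proof. by have [_ uu _] := cu => j; have [_ /(_ w)] := uu j. Qed.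

Lemma uniform_cube_prod (A : 'I_n -> set R) : (forall j, measurable (A j)) ->
  P [set w | forall j, A j (u w ord0 j)] =
  (\prod_j P [set w | A j (u w ord0 j)])%E.
Proof.
move=> mA; have [_ _ indu] := cu.
transitivity (P (\bigcap_(j in [set` enum 'I_n]) [set w | A j (u w ord0 j)])).
  apply: (congr1 P); apply/seteqP; split => w /= Aw j; first by move=> _.
  by apply: Aw; rewrite /= mem_enum.
rewrite (indu _ _ (enum_uniq _))//; first by rewrite big_enum.
by move=> j _; exists (A j) => //; rewrite setTI.
Qed.

Context (mu : probability 'rV[R]_n R).
Hypothesis invF : forall j, invertible_cdf mu j.
Hypothesis indep : indep_components mu.

Lemma law_antithetic A : measurable A -> P ((inv_transform mu \o u) @^-1` A) = mu A.
Proof.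
have [mu_ uu _] := cu; apply: law_inv_transform => //; first exact: uniform_cube_cube.
move=> t t01; rewrite (@uniform_cube_prod (fun j => `]-oo, t j]%classic)).
  apply: eq_bigr => j _; have /andP[t0 t1] := t01 j.
  transitivity (P [set w | (u w ord0 j <= t j)%R]).
    by apply: (congr1 P); apply/seteqP; split => w /=; rewrite in_itv.
  by rewrite (uniform_rv_le _ (uu j)) !subr0 divr1 max_r// min_r.
by move=> j; exact: measurable_itv.
Qed.

(** The reflection turns lower intervals into upper ones of the same length. *)
Lemma law_antithetic_mirror A : measurable A ->
  P ((inv_transform mu \o @mirror R n \o u) @^-1` A) = mu A.
Proof.
have [mu_ uu _] := cu.
apply: (law_inv_transform (v := @mirror R n \o u) invF indep) => //.
- exact: measurableT_comp (@measurable_mirror R n) mu_.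
- by move=> w; apply: mirror_cube; exact: uniform_cube_cube.
move=> t t01; transitivity (P [set w | forall j, `[1 - t j, +oo[%classic (u w ord0 j)]).
  apply: (congr1 P); apply/seteqP; split => w /= h j; have := h j;
  by rewrite !mxE in_itv/= andbT lerBlDr lerBlDl.
rewrite (@uniform_cube_prod (fun j => `[1 - t j, +oo[%classic)).
  apply: eq_bigr => j _; rewrite -(uniform_rv_ge (uu j) (t01 j)).
  by apply: (congr1 P); apply/seteqP; split => w /=;
    rewrite in_itv/= andbT lerBlDr lerBlDl.
by move=> j; exact: measurable_itv.
Qed.

End antithetic.
End uniform.

(** * Latin hypercube points *)

Section finite_unions.
Context d (T : measurableType d) (R : realType) (mu : {measure set T -> \bar R}).
Context (I : finType) (D : pred I) (F : I -> set T).
Hypothesis mF : forall i, D i -> measurable (F i).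

Let sum_fsbig : (\sum_(i | D i) mu (F i) = \sum_(i \in [set` D]) mu (F i))%E.
Proof.
rewrite -(big_filter _ D) [LHS]fsbig_seq; last by rewrite filter_uniq ?index_enum_uniq.
apply: eq_fsbigl; apply/seteqP; split => i /=; rewrite mem_filter mem_index_enum andbT//.
Qed.

Lemma measure_finType_bigcup : (forall i j, D i -> D j -> F i `&` F j !=set0 -> i = j) ->
  mu (\bigcup_(i in [set` D]) F i) = (\sum_(i | D i) mu (F i))%E.
Proof. by move=> tF; rewrite measure_fin_bigcup// sum_fsbig. Qed.

Lemma measurable_finType_bigcup : measurable (\bigcup_(i in [set` D]) F i).
Proof. exact: fin_bigcup_measurable. Qed.

Lemma le_measure_finType_bigcup A : measurable A -> A `<=` \bigcup_(i in [set` D]) F i ->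
  (mu A <= \sum_(i | D i) mu (F i))%E.
Proof. by move=> mA AF; rewrite sum_fsbig; exact: content_sub_fsum. Qed.

End finite_unions.

Section latin_hypercube.
Context d (Omega : measurableType d) (R : realType) (P : probability Omega R).

Section permutation.
Context (n : nat) (pi : Omega -> 'S_n).
Hypothesis upi : uniform_perm P pi.

Lemma perm_image_bigcup (i k : 'I_n) :
  [set w | pi w i = k] =
  \bigcup_(s in [set` [pred s : 'S_n | s i == k]]) (pi @^-1` [set s]).
Proof.
apply/seteqP; split => w /=; first by move=> pk; exists (pi w) => //=; apply/eqP.
by move=> [s /= /eqP <- ->].
Qed.

Lemma measurable_perm_image (i k : 'I_n) : measurable [set w | pi w i = k].
Proof.
rewrite perm_image_bigcup; apply: measurable_finType_bigcup => s _.
by have [] := upi s.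
Qed.

(** Composition with a transposition is a bijection between the permutations
    sending [i] to [k'] and those sending [i] to [k], so the [n] possible images of
    [i] share the [n`!] permutations equally. *)
Lemma card_perm_image (i k : 'I_n) :
  (#|[set s : 'S_n | s i == k]%SET| * n = n`!)%N.
Proof.
pose N k := #|[set s : 'S_n | s i == k]%SET|.
have NE k' : N k' = N k.
  rewrite /N -[LHS](card_imset _ (@mulIg _ (tperm k' k))); apply: eq_card => s.
  rewrite inE; apply/imsetP/idP => [[r]|/eqP sk].
    by rewrite inE => /eqP rk ->; rewrite permM rk tpermL.
  exists (s * tperm k' k)%g; last by rewrite -mulgA tperm2 mulg1.
  by rewrite inE permM sk tpermR.
rewrite -[RHS](card_Sn n) -[in RHS]sum1_card.
rewrite (partition_big (fun s : 'S_n => s i) xpredT)//=.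
rewrite (eq_bigr (fun=> N k)); last first.
  move=> k' _; rewrite -(NE k') /N -sum1_card; apply: eq_bigl => s.
  by rewrite !inE.
by rewrite sum_nat_const card_ord mulnC.
Qed.

Lemma uniform_perm_image (i k : 'I_n) : P [set w | pi w i = k] = (n%:R^-1)%:E.
Proof.
rewrite perm_image_bigcup measure_finType_bigcup; last 2 first.
- by move=> s _; have [] := upi s.
- by move=> s t _ _ [w [/= -> ->]].
rewrite (eq_bigr (fun=> (n`!%:R^-1)%:E)); last by move=> s _; have [] := upi s.
rewrite sumEFin sumr_const -(card_perm_image i k); congr EFin.
rewrite cardsE -[LHS]mulr_natl natrM invfM mulrA mulfV ?mul1r//.
rewrite pnatr_eq0 -lt0n; have := card_perm_image i k; rewrite cardsE.
by case: (#|_|)%N => //; rewrite mul0n => n0; have := fact_gt0 n; rewrite -n0.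
Qed.
End permutation.


(** Each interval [[k, k + 1]] contributes the length of its part below [y]. *)
Lemma sum_clamp (y : R) m : 0 <= y ->
  \sum_(k < m) Num.min 1 (Num.max 0 (y - k%:R)) = Num.min y m%:R.
Proof.
move=> y0; elim: m => [|m IHm]; first by rewrite big_ord0 min_r.
rewrite big_ord_recr/= IHm -natr1.
have [ym|my] := leP y m%:R.
  rewrite max_l ?subr_le0// (min_r ler01) addr0 min_l//.
  by rewrite (le_trans ym)// lerDl.
rewrite max_r ?subr_ge0; last exact: ltW.
have [ym1|my1] := leP y (m%:R + 1).
  by rewrite min_r ?subrKC// lerBlDl.
by rewrite min_l// lerBrDl ltW.
Qed.

Section lhs_marginal.
Context (n N : nat) (u : 'I_n -> 'I_N -> Omega -> R) (pi : 'I_n -> Omega -> 'S_N).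
Hypothesis uu : forall j (i : 'I_N), uniform_rv P (i%:R / N%:R) (i.+1%:R / N%:R) (u j i).
Hypothesis upi : forall j, uniform_perm P (pi j).
Hypothesis indu : mutual_indep P setT (fun t : 'I_n * option 'I_N =>
  match t.2 with
  | Some i => preimage_set_system setT (u t.1 i) measurable
  | None => preimage_set_system setT (pi t.1) setT
  end).
Context (i : 'I_N).

(** A point of the sample in the unit cube, before the inverse transform. *)
Definition stratified (w : Omega) : 'rV[R]_n := \row_j u j (pi j w i) w.

Let N0 : 0 < N%:R :> R.
Proof. by rewrite ltr0n (leq_ltn_trans _ (ltn_ord i)). Qed.

Lemma measurable_stratum_le j k t : measurable [set w | u j k w <= t].
Proof.
rewrite (_ : mkset _ = setT `&` u j k @^-1` `]-oo, t]).
  by have [mu_ _ _] := uu j k; exact: mu_.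
by rewrite setTI; apply/seteqP; split => w; rewrite /= in_itv.
Qed.

Lemma measurable_stratified : measurable_fun setT stratified.
Proof.
apply: measurable_rV => // j; apply: measurable_fun_rays => // t; rewrite setTI.
rewrite (_ : mkset _ = \bigcup_(k in [set` xpredT])
   ([set w | pi j w i = k] `&` [set w | u j k w <= t])).
  apply: measurable_finType_bigcup => k _; apply: measurableI.
    exact: measurable_perm_image.
  exact: measurable_stratum_le.
apply/seteqP; split => w /=; rewrite /coord mxE.
  by move=> ut; exists (pi j w i).
by move=> [k _ [/= ->]].
Qed.

Lemma stratified_cube w : cube (stratified w).
Proof.
move=> j; rewrite mxE; have [_ /(_ w)/andP[h1 h2] _] := uu j (pi j w i).
rewrite (le_lt_trans _ h1) ?divr_ge0//= (lt_le_trans h2)//.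
by rewrite ler_pdivrMr// mul1r ler_nat.
Qed.

(** Given the strata [phi j] which the permutations assign to the [i]-th point, the
    event splits into independent factors.  Summing over all [phi] and exchanging
    sum and product leaves in each coordinate a uniform choice of a stratum
    followed by a uniform choice inside it, that is, a uniform variable on the
    whole interval. *)
Lemma stratified_prod (t : 'I_n -> R) : (forall j, 0 <= t j <= 1) ->
  P [set w | forall j, stratified w ord0 j <= t j] = (\prod_j (t j)%:E)%E.
Proof.
move=> t01.
pose cl j (k : 'I_N) := Num.min 1 (Num.max 0 (N%:R * t j - k%:R)) : R.
have uE j k : P [set w | u j k w <= t j] = (cl j k)%:E.
  rewrite (uniform_rv_le _ (uu j k)); congr (Num.min 1 (Num.max 0 _))%:E.
  rewrite -mulrBl -natrB// subSnn mul1r invrK mulrBl divfK ?gt_eqF//.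
  by rewrite mulrC.
have tE j : t j = \sum_(k < N) N%:R^-1 * cl j k.
  have /andP[t0 t1] := t01 j.
  rewrite -mulr_sumr sum_clamp; last by rewrite mulr_ge0// ltW.
  rewrite min_l; first by rewrite mulKf// gt_eqF.
  by rewrite ler_piMr// ltW.
pose E (phi : {ffun 'I_n -> 'I_N}) :=
  [set w | forall j, pi j w i = phi j /\ u j (phi j) w <= t j].
rewrite (_ : mkset _ = \bigcup_(phi in [set` xpredT]) E phi); last first.
  apply/seteqP; split => [w /= wt|w [phi _] h j].
    exists [ffun j => pi j w i] => //= j; rewrite ffunE.
    by split => //; have := wt j; rewrite mxE.
  by rewrite mxE; have [-> ] := h j.
pose s (phi : {ffun 'I_n -> 'I_N}) : seq ('I_n * option 'I_N) :=
  [seq (j, None) | j <- enum 'I_n] ++ [seq (j, Some (phi j)) | j <- enum 'I_n].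
pose A (phi : {ffun 'I_n -> 'I_N}) (x : 'I_n * option 'I_N) : set Omega :=
  match x.2 with
  | None => [set w | pi x.1 w i = phi x.1]
  | Some k => [set w | u x.1 k w <= t x.1] end.
have EE phi : E phi = \bigcap_(x in [set` s phi]) A phi x.
  apply/seteqP; split => w /=.
    move=> h x /=; rewrite mem_cat => /orP[] /mapP[j _ ->]; rewrite /A/=.
      by have [] := h j.
    by have [] := h j.
  move=> h j; split.
    apply: (h (j, None)) => /=; rewrite mem_cat; apply/orP; left.
    by apply/mapP; exists j; rewrite ?mem_enum.
  apply: (h (j, Some (phi j))) => /=; rewrite mem_cat; apply/orP; right.
  by apply/mapP; exists j; rewrite ?mem_enum.
have mE phi : measurable (E phi).
  rewrite EE; apply: fin_bigcap_measurable; first exact: finite_seq.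
  move=> [j [k|]] _; rewrite /A/=; first exact: measurable_stratum_le.
  exact: measurable_perm_image.
have PE phi : P (E phi) = (\prod_j (N%:R^-1 * cl j (phi j)))%:E.
  rewrite EE indu//; last first.
  - move=> [j [k|]] _; rewrite /A/=.
      exists `]-oo, t j]%classic; first exact: measurable_itv.
      by rewrite setTI; apply/seteqP; split => w; rewrite /= in_itv.
    by exists [set r : 'S_N | r i = phi j] => //; rewrite setTI.
  - rewrite cat_uniq !map_inj_uniq ?enum_uniq//; last 2 first.
    + by move=> j k [].
    + by move=> j k [].
    rewrite -enumT enum_uniq andbT/=; apply/hasPn => _ /mapP[j _ ->].
    by apply/negP => /mapP[k _].
  rewrite big_cat/= !big_map -!enumT/= !big_enum/= /A/=.
  rewrite (eq_bigr (fun=> (N%:R^-1)%:E)); last by move=> j _; rewrite uniform_perm_image.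
  rewrite [X in (_ * X)%E](eq_bigr (fun j => (cl j (phi j))%:E)); last by move=> j _.
  by rewrite !prodEFin -EFinM big_split.
rewrite measure_finType_bigcup//; last first.
  move=> phi psi _ _ [w [h1 h2]]; apply/ffunP => j.
  by have [<- _] := h1 j; have [<- _] := h2 j.
rewrite (eq_bigr _ (fun phi _ => PE phi)) sumEFin prodEFin; congr EFin.
by rewrite (eq_bigr _ (fun j _ => tE j)) bigA_distr_bigA.
Qed.

End lhs_marginal.

Section lhs.
Context (n N : nat) (mu : probability 'rV[R]_n R) (xi : nat -> Omega -> 'rV[R]_n).
Hypothesis invF : forall j, invertible_cdf mu j.
Hypothesis indep : indep_components mu.
Hypothesis lhs : lhs_sample P mu N xi.

Lemma lhs_point i : (i < N)%N -> [/\ measurable_fun setT (xi i),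
  forall w, msupport mu (xi i w)
  & forall A, measurable A -> P (xi i @^-1` A) = mu A].
Proof.
have [u [pi [uu upi indu xiE]]] := lhs => iN.
pose o := Ordinal iN.
have {}xiE : xi i = inv_transform mu \o stratified u pi o.
  apply/funext => w; rewrite (xiE o); apply/rowP => j.
  by rewrite !mxE /coord mxE.
have cub := stratified_cube pi uu o.
have ms := measurable_stratified uu upi o.
rewrite xiE; split.
- apply: (measurable_comp (@measurable_cube R n)) => //.
    by move=> _ [w _ <-]; exact: cub.
  exact: measurable_inv_transform.
- by move=> w; exact: inv_transform_support.
- by apply: law_inv_transform => //; exact: stratified_prod.
Qed.

End lhs.
End latin_hypercube.

(** * Exponential moment bounds *)

Section exponential_bounds.
Context (R : realType).

(** From [1 - x <= expR (- x)] and [1 / (1 - x) <= 1 + x + 2 x^2]. *)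
Lemma expR_le_quad (x : R) : x <= 1 / 2 -> expR x <= 1 + x + 2 * x ^+ 2.
Proof.
move=> x2; have x1 : 0 < 1 - x by lra.
have h := expR_ge1Dx (- x).
have : expR x * (1 - x) <= 1.
  rewrite -[leRHS](expRxMexpNx_1 x) ler_pM2l ?expR_gt0//.
rewrite -ler_pdivlMr// => /le_trans; apply; rewrite ler_pdivrMr//.
nra.
Qed.

(** Hoeffding's lemma, up to the constant: in the mean the linear term of
    [expR_le_quad] vanishes and the quadratic one is bounded. *)
Lemma mgf_le d (T : measurableType d) (nu : {measure set T -> \bar R}) (D : set T)
    (g : T -> R) (B theta : R) :
  measurable D -> nu D = 1%E -> measurable_fun D g ->
  (forall z, D z -> `|g z| <= B) -> (\int[nu]_(z in D) (g z)%:E = 0)%E ->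
  `|theta| * B <= 1 / 2 ->
  (\int[nu]_(z in D) (expR (theta * g z))%:E <= (expR (2 * theta ^+ 2 * B ^+ 2))%:E)%E.
Proof.
move=> mD nuD mg gB g0 tB.
have nuoo : (nu D < +oo)%E by rewrite nuD ltry.
have intg : nu.-integrable D (EFin \o g).
  apply: measurable_bounded_integrable => //.
  exists B; split; first exact: num_real.
  by move=> b Bb z Dz; exact: le_trans (gB z Dz) (ltW Bb).
have intc (c : R) : nu.-integrable D (EFin \o cst c).
  apply: measurable_bounded_integrable => //.
  exists `|c|; split; first exact: num_real.
  by move=> b Bb z Dz; exact: ltW.
apply: (@le_trans _ _ (\int[nu]_(z in D)
    ((1 + 2 * theta ^+ 2 * B ^+ 2)%:E + theta%:E * (g z)%:E))%E).
  apply: ge0_le_integral => //.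
  - apply/measurable_EFinP; apply: measurableT_comp => //.
    exact: measurable_funM.
  - apply: emeasurable_funD => //; apply: emeasurable_funM => //.
    exact/measurable_EFinP.
  - move=> z Dz; rewrite -EFinM -EFinD lee_fin.
    have gz := gB z Dz.
    have tg : `|theta * g z| <= 1 / 2.
      by rewrite normrM (le_trans _ tB)// ler_wpM2l.
    apply: (le_trans (expR_le_quad (le_trans (ler_norm _) tg))).
    suff : (g z) ^+ 2 <= B ^+ 2.
      move=> gB2; have := sqr_ge0 theta; rewrite exprMn; nra.
    by rewrite -(ger0_norm (sqr_ge0 (g z))) normrX lerXn2r ?nnegrE// (le_trans _ gz).
rewrite integralD//; last 2 first.
- exact: intc.
- exact: integrableZl.
rewrite integralZl// g0 mule0 adde0 integral_cst// nuD mule1 lee_fin.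
exact: expR_ge1Dx.
Qed.

(** For variables bounded by [B], this exponent satisfies the condition of [mgf_le]
    and makes the quadratic term at most half of the linear gain
    [tilt B delta * delta]; a fourth of the gain pays for a rounding error
    [delta / 4], and the last fourth is the rate of decay. *)
Definition tilt (B delta : R) := Num.min (2 * B)^-1 (delta / (4 * B ^+ 2)).
Definition rate (B delta : R) := tilt B delta * delta / 4.

Context (B delta : R) (B0 : 0 < B) (delta0 : 0 < delta).

Lemma tilt_gt0 : 0 < tilt B delta.
Proof.
by rewrite lt_min invr_gt0 mulr_gt0//= divr_gt0// mulr_gt0// exprn_gt0.
Qed.

Lemma rate_gt0 : 0 < rate B delta.
Proof. by rewrite divr_gt0// mulr_gt0// tilt_gt0. Qed.

Lemma tilt_half : tilt B delta * B <= 1 / 2.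
Proof.
have : tilt B delta * B <= (2 * B)^-1 * B by rewrite ler_pM2r// ge_min lexx.
by move=> /le_trans; apply; rewrite invfM mulfVK ?gt_eqF// mul1r.
Qed.

Lemma tilt_rate : tilt B delta * (delta / 4) + 2 * tilt B delta ^+ 2 * B ^+ 2
  - tilt B delta * delta <= - rate B delta.
Proof.
have : tilt B delta * (4 * B ^+ 2) <= delta.
  have : tilt B delta <= delta / (4 * B ^+ 2) by rewrite ge_min lexx orbT.
  by rewrite ler_pdivlMr// mulr_gt0// exprn_gt0.
have := tilt_gt0; rewrite /rate; move: (tilt B delta) => t.
nra.
Qed.

End exponential_bounds.

Section chernoff.
Context d (Omega : measurableType d) (R : realType) (P : probability Omega R).

(** Chernoff's bound. *)
Lemma tail_of_mgf (S : Omega -> R) (theta M a : R) : measurable_fun setT S ->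
  0 < theta -> (\int[P]_w (expR (theta * S w))%:E <= M%:E)%E ->
  (P [set w | (a <= S w)%R] <= (M * expR (- (theta * a)))%:E)%E.
Proof.
move=> mS t0 SM.
pose X : {RV P >-> R} :=
  MeasurableFun.Pack (MeasurableFun.Class (isMeasurableFun.Build _ _ _ _ _ mS)).
apply: (le_trans (@chernoff _ _ _ P X theta a t0)).
rewrite EFinM lee_wpmul2r ?lee_fin ?expR_ge0//.
rewrite /mmt_gen_fun unlock (le_trans _ SM)// le_eqVlt; apply/orP; left.
by apply/eqP; apply: eq_integral => w _; rewrite /= mulrC.
Qed.

Section grid.
Context (q B : R) (q0 : 0 < q).

Definition cell (v : nat) : set R := `[- B + v%:R * q, - B + v.+1%:R * q[%classic.

Lemma cell_disjoint v v' y : cell v y -> cell v' y -> v = v'.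
Proof.
rewrite /cell /= !in_itv/= => /andP[h1 h2] /andP[h3 h4].
have : v%:R < v'.+1%:R :> R.
  by rewrite -(ltr_pM2r q0); lra.
have : v'%:R < v.+1%:R :> R.
  by rewrite -(ltr_pM2r q0); lra.
by rewrite !ltr_nat !ltnS => a b; apply/eqP; rewrite eqn_leq a b.
Qed.

Definition ncells := (Num.truncn (2 * B / q)).+1.

Lemma cell_cover (y : R) : `|y| <= B -> exists v : 'I_ncells, cell v y.
Proof.
rewrite ler_norml => /andP[y1 y2].
have yB : 0 <= (y + B) / q by rewrite divr_ge0 ?(ltW q0)//; lra.
have h : (Num.truncn ((y + B) / q) < ncells)%N.
  rewrite /ncells ltnS truncn_ge_nat; last by rewrite divr_ge0 ?(ltW q0)//; lra.
  have := yB; rewrite -truncn_le => /le_trans; apply.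
  by rewrite ler_pM2r ?invr_gt0//; lra.
exists (Ordinal h); rewrite /cell/= in_itv/=.
have := yB; rewrite -truncn_le ler_pdivlMr// => h1.
have := truncnS_gt ((y + B) / q); rewrite ltr_pdivrMr// => h2.
by apply/andP; split; lra.
Qed.

(** The sum is the integral of a step function: it takes at each [w] the value of
    the exponential at the left end of the cell of [Y w]. *)
Lemma lower_sum_le_mgf (Y : Omega -> R) (theta : R) : measurable_fun setT Y ->
  0 <= theta ->
  (\sum_(v < ncells) (expR (theta * (- B + v%:R * q)))%:E * P (Y @^-1` cell v)
    <= \int[P]_w (expR (theta * Y w))%:E)%E.
Proof.
move=> mY t0.
have mE v : measurable (Y @^-1` cell v).
  by rewrite -[X in measurable X]setTI; apply: mY => //; exact: measurable_itv.
pose c v := expR (theta * (- B + v%:R * q)).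
rewrite (eq_bigr (fun v : 'I_ncells =>
    \int[P]_w (c v * \1_(Y @^-1` cell v) w)%:E)%E); last first.
  move=> v _; under eq_integral do rewrite EFinM.
  rewrite ge0_integralZl//.
  - by rewrite integral_indic// setIT.
  - by apply/measurable_EFinP; exact: measurable_indic.
  - by rewrite lee_fin expR_ge0.
rewrite -ge0_integral_sum//; last 2 first.
- move=> v; apply/measurable_EFinP; exact: measurable_funM.
- by move=> v w _; rewrite lee_fin mulr_ge0// expR_ge0.
apply: ge0_le_integral => //.
- by move=> w _; apply: sume_ge0 => v _; rewrite lee_fin mulr_ge0// expR_ge0.
- apply: emeasurable_sum => v; apply/measurable_EFinP; exact: measurable_funM.
- apply/measurable_EFinP; apply: measurableT_comp => //.
  exact: measurable_funM.
move=> w _; rewrite sumEFin lee_fin.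
have [[v0 Yv0]|nY] := pselect (exists v : 'I_ncells, cell v (Y w)); last first.
  rewrite big1 ?expR_ge0// => v _; rewrite indicE memNset ?mulr0// => Yv.
  by apply: nY; exists v.
rewrite (bigD1 v0)//= big1 ?addr0; last first.
  move=> v vv0; rewrite indicE memNset ?mulr0// => Yv.
  by move/eqP: vv0; apply; apply/val_inj; exact: cell_disjoint Yv Yv0.
rewrite indicE mem_set// mulr1 ler_expR ler_wpM2l//.
by move: Yv0; rewrite /cell/= in_itv/= => /andP[].
Qed.

End grid.

(** Chernoff's bound for independent centred variables, jointly with an event [A]
    independent of them.  The variables are rounded up to a grid of mesh
    [delta / 4].  A rounded sample takes finitely many values, so the exponential
    moment of its sum is a finite sum over product events, to which independence
    applies directly. *)
Lemma chernoff_indep (m : nat) (Y : 'I_m -> Omega -> R) (A : set Omega) (B delta : R) :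
  0 < B -> 0 < delta ->
  (forall i, measurable_fun setT (Y i)) -> (forall i w, `|Y i w| <= B) ->
  (forall i, \int[P]_w (Y i w)%:E = 0)%E -> measurable A ->
  (forall S : 'I_m -> set R, (forall i, measurable (S i)) ->
     P (A `&` [set w | forall i, S i (Y i w)]) =
     (P A * \prod_i P (Y i @^-1` S i))%E) ->
  (P (A `&` [set w | (m%:R * delta <= \sum_i Y i w)%R]) <=
   P A * (expR (- (rate B delta * m%:R)))%:E)%E.
Proof.
move=> B0 d0 mY YB Y0 mA indY.
set t := tilt B delta; have t0 : 0 < t := tilt_gt0 B0 d0.
pose q := delta / 4; have q0 : 0 < q by rewrite divr_gt0.
pose V := ncells q B.
pose lo (v : nat) : R := - B + v%:R * q.
have mE i v : measurable (Y i @^-1` cell q B v).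
  by rewrite -[X in measurable X]setTI; apply: mY => //; exact: measurable_itv.
pose p i (v : 'I_V) := fine (P (Y i @^-1` cell q B v)).
have pE i (v : 'I_V) : P (Y i @^-1` cell q B v) = (p i v)%:E.
  by rewrite fineK ?fin_num_measure.
have p0 i v : 0 <= p i v by rewrite fine_ge0.
(* the tilted mass of one rounded variable, lo v + q being the upper end of
   the v-th cell *)
have sump i : \sum_(v : 'I_V) expR (t * (lo v + q - delta)) * p i v
    <= expR (- rate B delta).
  have := lower_sum_le_mgf B q0 (mY i) (ltW t0).
  have tB : `|t| * B <= 1 / 2 by rewrite gtr0_norm//; exact: tilt_half.
  move=> /le_trans/(_ (mgf_le measurableT (probability_setT P) (mY i)
    (fun w _ => YB i w) (Y0 i) tB)).
  under eq_bigr do rewrite pE -EFinM.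
  rewrite sumEFin lee_fin => h.
  under eq_bigr do rewrite -addrA mulrDr expRD mulrAC.
  rewrite -mulr_suml (le_trans (ler_wpM2r (expR_ge0 _) h))// -expRD ler_expR.
  have := tilt_rate B0 d0; rewrite -/t /q; move: (rate _ _) => r; lra.
pose F (phi : {ffun 'I_m -> 'I_V}) :=
  A `&` [set w | forall i, cell q B (phi i) (Y i w)].
have PF phi : P (F phi) = (P A * (\prod_i p i (phi i))%:E)%E.
  rewrite /F (indY (fun i => cell q B (phi i))); last by move=> i; exact: measurable_itv.
  by congr *%E; rewrite -prodEFin; apply: eq_bigr => i _; rewrite -pE.
have mF phi : measurable (F phi).
  apply: measurableI => //.
  rewrite (_ : mkset _ = \bigcap_(i in [set: 'I_m]) (Y i @^-1` cell q B (phi i))).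
    by apply: fin_bigcap_measurable.
  by apply/seteqP; split => [w h i _|w h i]; [exact: h|exact: (h i Logic.I)].
pose D (phi : {ffun 'I_m -> 'I_V}) := m%:R * delta <= \sum_i (lo (phi i) + q).
have mev : measurable (A `&` [set w | (m%:R * delta <= \sum_i Y i w)%R]).
  apply: measurableI => //.
  by apply: measurable_superlevel; exact: measurable_sum.
apply: (le_trans (@le_measure_finType_bigcup _ _ _ P _ D F _ _ mev _)) => //.
  move=> w [Aw mw].
  have [phi phiP] := choice (fun i => cell_cover q0 (YB i w)).
  have Dphi : D [ffun i => phi i].
    rewrite /D; apply: (le_trans mw); apply: ler_sum => i _; rewrite ffunE.
    have := phiP i; rewrite /cell/= in_itv/= -natr1 mulrDl mul1r => /andP[_].
    by rewrite /lo; lra.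
  by exists [ffun i => phi i] => //; split => // i; rewrite ffunE.
rewrite (eq_bigr (fun phi : {ffun 'I_m -> 'I_V} =>
    P A * (\prod_i p i (phi i))%:E)%E); last by move=> phi _; exact: PF.
rewrite -ge0_sume_distrr; last by move=> phi _; rewrite lee_fin prodr_ge0.
rewrite lee_wpmul2l// sumEFin lee_fin.
(* on the product events of large sum the tilting factor is at least 1; the
   other product events are then added for the sum to factor *)
apply: (@le_trans _ _ (\sum_(phi : {ffun 'I_m -> 'I_V})
    \prod_i (expR (t * (lo (phi i) + q - delta)) * p i (phi i)))).
  rewrite [leRHS](bigID D)/= ler_wpDr//.
    by apply: sumr_ge0 => phi _; apply: prodr_ge0 => i _; rewrite mulr_ge0 ?expR_ge0.
  apply: ler_sum => phi Dphi; rewrite big_split/= -expR_sum ler_peMl ?prodr_ge0//.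
  rewrite -expR0 ler_expR -mulr_sumr mulr_ge0 ?(ltW t0)//.
  by rewrite sumrB subr_ge0 sumr_const card_ord -mulr_natl.
rewrite -(bigA_distr_bigA (fun i (v : 'I_V) => expR (t * (lo v + q - delta)) * p i v)).
rewrite mulrC -mulrN expRM_natl -[X in _ <= _ ^+ X]card_ord -prodr_const.
apply: ler_prod => i _; rewrite sump andbT; apply: sumr_ge0 => v _.
by rewrite mulr_ge0 ?expR_ge0.
Qed.

End chernoff.

(** * Equicontinuity of the integrand *)

Section compact_sets.
Context (R : realType) (n : nat) (X : set 'rV[R]_n).
Hypothesis cX : compact X.

Lemma measurable_open_rV (U : set 'rV[R]_n) : open U -> measurable U.
Proof. exact: sub_sigma_algebra. Qed.

Lemma measurable_closed_rV (K : set 'rV[R]_n) : closed K -> measurable K.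
Proof.
move=> cK; rewrite -(setCK K); apply: measurableC; apply: measurable_open_rV.
exact: closed_openC.
Qed.

Lemma measurable_compact : measurable X.
Proof.
apply: measurable_closed_rV; apply: compact_closed => //; exact: norm_hausdorff.
Qed.

Lemma finite_net (e : R) : 0 < e ->
  exists s : seq 'rV[R]_n, (forall y, y \in s -> X y) /\
    forall x, X x -> exists2 y, y \in s & `|x - y| < e.
Proof.
move=> e0; have := cX; rewrite compact_cover => /(_ _ X (fun y => ball y e)).
case=> [y _|x Xx|D DX XD]; first exact: ball_open.
  by exists x => //; exact: ballxx.
exists (finmap.enum_fset D); split=> [y yD|x Xx].
  by have := DX y yD; rewrite inE.
have [y yD xy] := XD x Xx; exists y => //.
by move: xy; rewrite -ball_normE /ball_/= distrC.
Qed.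

Lemma natSinv_lt (e : R) : 0 < e -> exists k : nat, k.+1%:R^-1 < e.
Proof.
move=> e0; have [k _ /(_ k (leqnn k)) ke] := near_infty_natSinv_lt (PosNum e0).
by exists k.
Qed.

Lemma dense_sequence : X !=set0 -> exists c : nat -> 'rV[R]_n,
  (forall i, X (c i)) /\ forall x e, X x -> 0 < e -> exists i, `|x - c i| < e.
Proof.
move=> [x0 Xx0].
have net (k : nat) : exists s : seq 'rV[R]_n, (forall y, y \in s -> X y) /\
    forall x, X x -> exists2 y, y \in s & `|x - y| < k.+1%:R^-1.
  by apply: finite_net; rewrite invr_gt0.
have [s sP] := choice net.
(* the finite nets of mesh 1 / (k + 1), enumerated one after the other *)
exists (fun i => if (@choice.unpickle (nat * nat)%type i) is Some kj
  then nth x0 (s kj.1) kj.2 else x0).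
split => [i|x e Xx e0].
  case: (choice.unpickle i) => // -[k j] /=; have [jk|kj] := ltnP j (size (s k)).
    by apply: (sP k).1; exact: mem_nth.
  by rewrite nth_default.
have [k ke] := natSinv_lt e0.
have [y ys xy] := (sP k).2 x Xx.
exists (choice.pickle (k, index y (s k))); rewrite choice.pickleK/= nth_index//.
exact: lt_trans ke.
Qed.

(** The Heine-Cantor theorem. *)
Lemma uniform_continuity (g : 'rV[R]_n -> R) (delta : R) :
  {within X, continuous g} -> 0 < delta ->
  exists m : nat, forall x y, X x -> X y -> `|x - y| < m.+1%:R^-1 ->
    `|g x - g y| <= delta.
Proof.
move=> /subspace_continuousP cg d0.
have /compact_near_coveringP /(_ nat \oo
  (fun m x => X x -> forall y, X y -> `|x - y| < m.+1%:R^-1 ->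
    `|g x - g y| <= delta)) := cX.
case=> [x Xx|m _ mP]; last first.
  by exists m => x y Xx Xy; apply: (mP m) => //=.
have d20 : 0 < delta / 2 by rewrite divr_gt0.
have /cvgrPdist_lt /(_ _ d20) := cg x Xx.
rewrite near_withinE => /nbhs_ballP[e /= e0 eg].
have e20 : 0 < e / 2 by rewrite divr_gt0.
exists (ball x (e / 2), [set m : nat | m.+1%:R^-1 < e / 2]) => /=.
  split; first exact: nbhsx_ballx.
  exact: (near_infty_natSinv_lt (PosNum e20)).
move=> [x' m] /= [xx' me] Xx' y Xy x'y.
have gx' : `|g x - g x'| < delta / 2.
  by apply: eg => //; apply: le_ball xx'; rewrite ler_pdivrMr// ler_pMr ?ler1n.
have gy : `|g x - g y| < delta / 2.
  apply: eg => //; rewrite -ball_normE /ball_/=.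
  move: xx'; rewrite -ball_normE /ball_/= => xx'.
  rewrite (splitr e) (le_lt_trans (ler_distD x' x y))// ltrD//.
  exact: lt_trans me.
rewrite (le_trans (ler_distD (g x) _ _))// distrC (splitr delta).
by rewrite ltW// ltrD.
Qed.

End compact_sets.

Section equicontinuity.
Context (R : realType) (dx dxi : nat) (X : set 'rV[R]_dx)
  (f : 'rV[R]_dx -> 'rV[R]_dxi -> R) (mu : probability 'rV[R]_dxi R) (C : R).
Hypothesis f_meas : measurable_fun (X `*` msupport mu) (fun z => f z.1 z.2).
Hypothesis f_cont : {ae mu, forall z, {within X, continuous (f^~ z)}}.
Hypothesis f_bnd : forall x z, X x -> msupport mu z -> `|f x z| <= C.
Hypothesis X0 : X !=set0.
Hypothesis cX : compact X.
Hypothesis mu_supp : mu (msupport mu) = 1%E.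

Lemma closed_msupport : closed (msupport mu).
Proof.
rewrite -[X in closed X]setCK; apply: open_closedC; rewrite openE => z /= nz.
have [U [oU Uz mU]] : exists U, [/\ open U, U z & ~ (0 < mu U)%E].
  apply: contrapT => nU; apply: nz => U oU Uz; apply: contrapT => mU.
  by apply: nU; exists U.
apply: filterS (open_nbhs_nbhs (conj oU Uz)) => y Uy sy.
exact: mU (sy U oU Uy).
Qed.

Lemma measurable_msupport : measurable (msupport mu).
Proof. exact: measurable_closed_rV closed_msupport. Qed.

Let mX : measurable X := measurable_compact cX.
Let mS : measurable (msupport mu) := measurable_msupport.

Let Soo : (mu (msupport mu) < +oo)%E.
Proof. by rewrite mu_supp ltry. Qed.

Let integral_supp_cst (c : R) : (\int[mu]_(z in msupport mu) c%:E = c%:E)%E.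
Proof. by rewrite integral_cst// [X in (_ * X)%E]mu_supp mule1. Qed.

Lemma measurable_section x : X x -> measurable_fun (msupport mu) (f x).
Proof.
move=> Xx; apply: (measurable_comp (F := X `*` msupport mu)
   (f := fun z : 'rV[R]_dx * 'rV[R]_dxi => f z.1 z.2) (g := fun z => (x, z))) => //.
- exact: measurableX.
- by move=> _ [z Sz <-].
- exact: measurable_funTS (pair1_measurable _).
Qed.

Lemma integrable_section x : X x -> mu.-integrable (msupport mu) (EFin \o f x).
Proof.
move=> Xx; apply: measurable_bounded_integrable => //.
- exact: measurable_section.
- exists C; split; first exact: num_real.
  by move=> b Cb z Sz; exact: le_trans (f_bnd Xx Sz) (ltW Cb).
Qed.

Lemma EfE x : X x -> (Ef f mu x)%:E = (\int[mu]_(z in msupport mu) (f x z)%:E)%E.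
Proof.
move=> Xx; rewrite /Ef /Rintegral fineK// integrable_fin_num//.
exact: integrable_section.
Qed.

Lemma integral_centered x : X x ->
  (\int[mu]_(z in msupport mu) (f x z - Ef f mu x)%:E = 0)%E.
Proof.
move=> Xx; under eq_integral do rewrite EFinB.
rewrite integralB//; last 2 first.
- exact: integrable_section.
- apply: measurable_bounded_integrable => //.
  by exists `|Ef f mu x|; split; rewrite ?num_real// => b bE z _; exact: ltW.
by rewrite integral_supp_cst -EfE// -EFinB subrr.
Qed.

Lemma Ef_bounded x : X x -> `|Ef f mu x| <= C.
Proof.
move=> Xx; rewrite /Ef (le_trans (le_normr_Rintegral _ (integrable_section Xx)))//.
rewrite -lee_fin /Rintegral fineK; last first.
  by apply: integrable_fin_num => //; exact: integrable_abse (integrable_section Xx).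
apply: (@le_trans _ _ (\int[mu]_(z in msupport mu) C%:E)%E).
  apply: ge0_le_integral => //.
  - by apply/measurable_EFinP; apply: measurableT_comp => //; exact: measurable_section.
  - by move=> z Sz; rewrite lee_fin; exact: f_bnd.
by rewrite integral_supp_cst.
Qed.

(** The integrands differ by at most [delta] on [G] and [2 * C] off [G]. *)
Lemma Ef_dist (G : set 'rV[R]_dxi) (delta eta : R) x y : X x -> X y ->
  measurable G -> (mu (~` G) <= eta%:E)%E ->
  (forall z, G z -> msupport mu z -> `|f x z - f y z| <= delta) -> 0 <= delta ->
  `|Ef f mu x - Ef f mu y| <= delta + 2 * C * eta.
Proof.
move=> Xx Xy mG Geta fG d0.
have C0 : 0 <= C.
  have [z Sz] : msupport mu !=set0.
    apply/set0P/eqP => S0; move: mu_supp; rewrite S0 measure0 => /eqP.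
    by rewrite eqe eq_sym oner_eq0.
  exact: le_trans (f_bnd Xx Sz).
have ixy : mu.-integrable (msupport mu) (EFin \o (fun z => f x z - f y z)).
  rewrite (_ : _ \o _ = (fun z => (f x z)%:E - (f y z)%:E)%E); last first.
    by apply/funext => z; rewrite /= EFinB.
  by apply: integrableB => //; exact: integrable_section.
have mxy : measurable_fun (msupport mu) (fun z => f x z - f y z).
  by apply: measurable_funB; exact: measurable_section.
rewrite /Ef -RintegralB//; try exact: integrable_section.
rewrite (le_trans (le_normr_Rintegral _ ixy))//.
rewrite -lee_fin /Rintegral fineK; last first.
  by apply: integrable_fin_num => //; exact: integrable_abse ixy.
apply: (@le_trans _ _ (\int[mu]_(z in msupport mu)
    (delta%:E + (2 * C)%:E * (\1_(~` G) z)%:E))%E).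
  apply: ge0_le_integral => //.
  - by apply/measurable_EFinP; apply: measurableT_comp.
  - apply: emeasurable_funD => //; apply: emeasurable_funM => //.
    by apply/measurable_EFinP; apply: measurable_indic; exact: measurableC.
  - move=> z Sz; rewrite -EFinM -EFinD lee_fin indicE.
    have [Gz|nGz] := pselect (G z).
      rewrite memNset; last by move/(_ Gz).
      by rewrite mulr0 addr0; exact: fG.
    rewrite mem_set// mulr1 ler_wpDl// (le_trans (ler_normB _ _))//.
    by have := f_bnd Xx Sz; have := f_bnd Xy Sz; lra.
rewrite ge0_integralD//; last 2 first.
- by move=> z _; rewrite mule_ge0// lee_fin// mulr_ge0.
- apply: emeasurable_funM => //.
  by apply/measurable_EFinP; apply: measurable_indic; exact: measurableC.
rewrite integral_supp_cst ge0_integralZl//; last 2 first.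
- by apply/measurable_EFinP; apply: measurable_indic; exact: measurableC.
- by rewrite lee_fin mulr_ge0.
rewrite integral_indic//; last exact: measurableC.
rewrite EFinD [X in (_ <= _ + X)%E]EFinM leeD2l// lee_wpmul2l ?lee_fin ?mulr_ge0//.
apply: le_trans Geta; apply: le_measure; rewrite ?inE//.
  by apply: measurableI => //; apply: measurableC.
by apply: measurableC.
Qed.

(** In the manner of Egorov's theorem: the continuous sections are uniformly
    continuous on the compact [X], with a modulus that depends on [z].  The sets of
    those [z] for which [1 / (m + 1)] is a modulus increase with [m] to a set of
    measure 1, so one of them has measure at least [1 - eta].  Testing the
    modulus on a dense sequence only makes these sets measurable. *)
Lemma equicontinuous_on_large_set (delta eta : R) : 0 < delta -> 0 < eta ->
  exists (e : R) (G : set 'rV[R]_dxi), [/\ 0 < e, measurable G,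
    G `<=` msupport mu, (mu (~` G) <= eta%:E)%E
    & forall z x y, G z -> X x -> X y -> `|x - y| < e -> `|f x z - f y z| <= delta].
Proof.
move=> d0 eta0.
have [c [Xc dense]] := dense_sequence cX X0.
have [N [mN N0 NP]] := f_cont.
have Ncont z : ~ N z -> {within X, continuous (f^~ z)}.
  by move=> nN; apply: contrapT => nc; apply: nN; exact: NP.
pose B (m : nat) := \bigcap_i \bigcap_j
  [set z | msupport mu z /\ (`|c i - c j| < m.+1%:R^-1 ->
    `|f (c i) z - f (c j) z| <= delta)].
pose G m := B m `\` N.
have mB m : measurable (B m).
  apply: bigcapT_measurable => i; apply: bigcapT_measurable => j.
  have [cij|ncij] := pselect (`|c i - c j| < m.+1%:R^-1); last first.
    rewrite (_ : mkset _ = msupport mu)//.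
    by apply/seteqP; split => z //= [].
  rewrite (_ : mkset _ = msupport mu `&`
      (fun z => `|f (c i) z - f (c j) z|) @^-1` `]-oo, delta]%classic).
    apply: measurableT_comp => //; try exact: measurable_itv.
    by apply: measurable_funB; exact: measurable_section.
  apply/seteqP; split => z /=; rewrite in_itv/= => -[Sz h]; split => //.
  exact: h.
have mG m : measurable (G m) by exact: measurableD.
have ndG : nondecreasing_seq G.
  move=> m k mk; apply/subsetPset => z [Bz Nz]; split => // i _ j _.
  have [Sz h] := Bz i Logic.I j Logic.I; split => // cij; apply: h.
  by rewrite (lt_le_trans cij)// lef_pV2 ?posrE// ler_nat.
have UG : \bigcup_m G m = msupport mu `\` N.
  apply/seteqP; split => z.
    by move=> [m _ [Bz Nz]]; split => //; have [] := Bz 0%N Logic.I 0%N Logic.I.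
  move=> [Sz Nz]; have [m mP] := uniform_continuity cX (Ncont z Nz) d0.
  by exists m => //; split => // i _ j _; split => // cij; exact: mP.
have muUG : mu (\bigcup_m G m) = 1%E.
  rewrite UG measureD// [X in (X - _)%E]mu_supp [X in (_ - X)%E](_ : _ = 0%E) ?sube0//.
  by apply: (subset_measure0 (B := N)) => //; exact: measurableI.
have cvG := nondecreasing_cvg_mu (mu := mu) mG (bigcupT_measurable _ mG) ndG.
have : ((1 - eta)%:E < limn (mu \o G))%E.
  have -> : limn (mu \o G) = 1%E by rewrite -muUG; exact: cvg_lim cvG.
  by rewrite lte_fin; lra.
move=> /lte_lim => /(_ _ _)[||m _ /(_ m (leqnn m)) mP].
- by move=> m k mk; rewrite le_measure ?inE//; apply/subsetPset; exact: ndG.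
- by apply/cvg_ex; exists (mu (\bigcup_m G m)).
exists m.+1%:R^-1, (G m); split => //.
- by move=> z [Bz _]; have [] := Bz 0%N Logic.I 0%N Logic.I.
- rewrite probability_setC// leeBlDr ?fin_num_measure//.
  apply: (@le_trans _ _ (eta%:E + (1 - eta)%:E)%E); last by rewrite leeD2l.
  by rewrite -EFinD lee_fin; lra.
move=> z x y [Bz Nz] Xx Xy xy; apply/ler_addgt0Pr => r r0.
have r20 : 0 < r / 2 by rewrite divr_gt0.
have /subspace_continuousP cz := Ncont z Nz.
have near x' : X x' -> exists i, `|f x' z - f (c i) z| < r / 2 /\
    `|x' - c i| < (m.+1%:R^-1 - `|x - y|) / 2.
  move=> Xx'; have /cvgrPdist_lt /(_ _ r20) := cz x' Xx'.
  rewrite near_withinE => /nbhs_ballP[e /= e0 eg].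
  set rho := (m.+1%:R^-1 - `|x - y|) / 2.
  have rho0 : 0 < rho by rewrite divr_gt0// subr_gt0.
  have [|i] := dense x' (Num.min e rho) Xx'; first by rewrite lt_min e0.
  rewrite lt_min => /andP[ie irho]; exists i; split => //.
  by apply: eg => //; rewrite -ball_normE.
have [i [fi xi]] := near x Xx; have [j [fj yj]] := near y Xy.
have [_ h] := Bz i Logic.I j Logic.I.
have cij : `|c i - c j| < m.+1%:R^-1.
  have h1 := ler_distD x (c i) (c j); have h2 := ler_distD y x (c j).
  rewrite (distrC (c i) x) in h1; move: xi yj h1 h2.
  by move: (m.+1%:R^-1 : R) `|x - y| => e1 e2; lra.
have h1 := ler_distD (f (c i) z) (f x z) (f y z).
have h2 := ler_distD (f (c j) z) (f (c i) z) (f y z).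
have := h cij; rewrite (distrC (f (c j) z) (f y z)) in h2; lra.
Qed.

Lemma Ef_uniformly_continuous (delta : R) : 0 < delta ->
  exists2 e : R, 0 < e & forall x y, X x -> X y -> `|x - y| < e ->
    `|Ef f mu x - Ef f mu y| <= delta.
Proof.
move=> d0; have d20 : 0 < delta / 2 by rewrite divr_gt0.
have C1 : 0 < 2 * (`|C| + 1) by rewrite mulr_gt0// ltr_pwDr.
have [e [G [e0 mG GS Geta GP]]] :=
  equicontinuous_on_large_set d20 (divr_gt0 d20 C1).
exists e => // x y Xx Xy xy.
apply: (le_trans (Ef_dist Xx Xy mG Geta _ (ltW d20))).
  by move=> z Gz _; exact: GP.
rewrite [leRHS](splitr delta) lerD2l mulrA ler_pdivrMr// mulrC ler_pM2l//.
by rewrite ler_wpM2l// (le_trans (ler_norm C))// lerDl.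
Qed.

Lemma measurable_Ef : measurable_fun X (Ef f mu).
Proof.
have cEf x : X x -> Ef f mu @ within X (nbhs x) --> Ef f mu x.
  move=> Xx; apply/cvgrPdist_le => e e0.
  have [r r0 rP] := Ef_uniformly_continuous e0.
  rewrite near_withinE; apply/nbhs_ballP; exists r => //= y.
  by rewrite -ball_normE => xy Xy; exact: rP.
apply: measurable_fun_rays => // t.
apply: measurable_closed_rV => x clx.
have Xx : X x.
  apply: (compact_closed (@norm_hausdorff _ _) cX) => U /clx[y [[Xy _] Uy]].
  by exists y.
split => //=; apply/ler_addgt0Pr => e e0.
have [r r0 rP] := Ef_uniformly_continuous e0.
have [y [[Xy yt] xy]] := clx (ball x r) (nbhsx_ballx x r r0).
have := rP x y Xx Xy; rewrite -ball_normE in xy => /(_ xy).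
by rewrite ler_norml => /andP[_]; rewrite /= in yt; lra.
Qed.

End equicontinuity.

(** * Samples with exponential tails *)

Section regular.
Context d (Omega : measurableType d) (R : realType) (P : probability Omega R).
Context (dx dxi : nat) (X : set 'rV[R]_dx) (f : 'rV[R]_dx -> 'rV[R]_dxi -> R)
  (mu : probability 'rV[R]_dxi R) (C : R).
Hypothesis C0 : 0 < C.
Hypothesis f_meas : measurable_fun (X `*` msupport mu) (fun z => f z.1 z.2).
Hypothesis f_bnd : forall x z, X x -> msupport mu z -> `|f x z| <= C.
Hypothesis cX : compact X.
Hypothesis mu_supp : mu (msupport mu) = 1%E.

Definition deviation (s : method) (m : nat) (z : nat -> Omega -> 'rV[R]_dxi) x w : R :=
  sample_avg m (obs f s (fun i => z i w)) x - Ef f mu x.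

(** What the rest of the proof needs to know of a sample of [m] observations,
    whatever the sampling method.  The events of [F], which are those of the
    candidates, are independent of the sample; this is stated for the two kinds
    of events of interest, the position of a single point and the deviation of
    the average at a fixed [x].  The rate of the exponential tail depends neither
    on [x] nor on [m]. *)
Record regular_sample (F : set (set Omega)) (s : method) (m : nat)
    (z : nat -> Omega -> 'rV[R]_dxi) : Prop := RegularSample {
  rs_meas : forall i, (i < m * points_per_obs s)%N -> measurable_fun setT (z i) ;
  rs_supp : forall i w, (i < m * points_per_obs s)%N -> msupport mu (z i w) ;
  rs_law : forall A i Z, F A -> (i < m * points_per_obs s)%N -> measurable Z ->
    P (A `&` z i @^-1` Z) = (P A * mu Z)%E ;
  rs_tail : forall A x (delta : R), F A -> X x -> 0 < delta ->
    (P (A `&` [set w | delta <= `|deviation s m z x w|]%R) <=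
     P A * (2 * expR (- (rate (2 * C) delta * m%:R)))%:E)%E }.

Let f_sec x (Xx : X x) : measurable_fun (msupport mu) (f x) :=
  measurable_section f_meas cX Xx.

Lemma centered_bound x z : X x -> msupport mu z -> `|f x z - Ef f mu x| <= 2 * C.
Proof.
move=> Xx Sz; rewrite (le_trans (ler_normB _ _))//.
have := f_bnd Xx Sz; have := Ef_bounded f_meas f_bnd cX mu_supp Xx; lra.
Qed.

Lemma measurable_f_point x (z : Omega -> 'rV[R]_dxi) : X x ->
  measurable_fun setT z -> (forall w, msupport mu (z w)) ->
  measurable_fun setT (fun w => f x (z w)).
Proof.
move=> Xx mz Sz; apply: (measurable_comp (F := msupport mu) (f := f x) (g := z)) => //.
- exact: measurable_msupport.
- by move=> _ [w _ <-].
- exact: f_sec.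
Qed.

Lemma two_sided_tail (A : set Omega) (S : Omega -> R) (dev : Omega -> R) m delta M :
  measurable A -> measurable_fun setT S -> (0 < m)%N ->
  (forall w, dev w = m%:R^-1 * S w) ->
  (P (A `&` [set w | m%:R * delta <= S w]%R) <= P A * M%:E)%E ->
  (P (A `&` [set w | m%:R * delta <= - S w]%R) <= P A * M%:E)%E ->
  (P (A `&` [set w | delta <= `|dev w|]%R) <= P A * (2 * M)%:E)%E.
Proof.
move=> mA mS m0 devE h1 h2.
have m0' : 0 < m%:R :> R by rewrite ltr0n.
have mdev : measurable_fun setT (fun w => `|dev w|).
  apply: measurableT_comp => //; rewrite (_ : dev = fun w => m%:R^-1 * S w).
    exact: measurable_funM.
  exact/funext.
have mS' : measurable_fun setT (fun w => - S w) by exact: measurableT_comp.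
apply: (@le_trans _ _ (P ((A `&` [set w | m%:R * delta <= S w]%R) `|`
    (A `&` [set w | m%:R * delta <= - S w]%R)))).
  apply: le_measure; rewrite ?inE.
  - by apply: measurableI => //; exact: measurable_superlevel.
  - by apply: measurableU; apply: measurableI => //; exact: measurable_superlevel.
  - move=> w [Aw /=]; rewrite devE normrM gtr0_norm ?invr_gt0// mulrC.
    rewrite ler_pdivlMr// mulrC ler_normr => /orP[h|h]; [left|right]; split => //.
apply: (le_trans (measureU2 _ _ _)); 
  try by apply: measurableI => //; exact: measurable_superlevel.
apply: (le_trans (leeD h1 h2)).
rewrite -muleDr ?fin_num_measure//.
by rewrite -EFinD mulrDl mul1r.
Qed.

Lemma deviation_lhs m z x w : (0 < m)%N ->
  deviation LatinHypercube m z x w = m%:R^-1 * \sum_(i < m) (f x (z i w) - Ef f mu x).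
Proof.
move=> m0; rewrite /deviation /sample_avg sumrB sumr_const card_ord mulrBr.
by rewrite -[X in _ - _ * X]mulr_natl mulKf// pnatr_eq0 -lt0n.
Qed.

Section lhs.
Context (F : set (set Omega)) (m : nat) (z : nat -> Omega -> 'rV[R]_dxi).
Hypothesis invF : forall j, invertible_cdf mu j.
Hypothesis indep : indep_components mu.
Hypothesis HA2 : A2_LHS P mu f X.
Hypothesis lhs : lhs_sample P mu m z.
Hypothesis m2 : (2 <= m)%N.
Hypothesis mF : F `<=` measurable.
Hypothesis indepF : forall A B, F A -> sigma_rvs `I_m z B -> P (A `&` B) = (P A * P B)%E.

(* Omega with the sigma-algebra generated by the sample, whose events are
   independent of those of F *)
Let Os := g_sigma_algebraType
  (\bigcup_(i in `I_m) preimage_set_system setT (z i) measurable).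

Let measurable_z i : (i < m)%N -> measurable_fun [set: Os] (z i : Os -> _).
Proof.
move=> im _ Z mZ; apply: sub_sigma_algebra; exists i => //=; by exists Z.
Qed.

Let measurable_S x : X x ->
  measurable_fun [set: Os] (fun w : Os => \sum_(i < m) (f x (z i w) - Ef f mu x)).
Proof.
move=> Xx; apply: measurable_sum => i; apply: measurable_funB => //.
apply: (measurable_comp (F := msupport mu) (f := f x) (g := z i : Os -> _)) => //.
- exact: measurable_msupport.
- by move=> _ [w _ <-]; have [_ + _] := lhs_point invF indep lhs (ltn_ord i); exact.
- exact: f_sec.
- exact: measurable_z.
Qed.

Let lhs_mgf x (theta : R) : X x -> `|theta| * (2 * C) <= 1 / 2 ->
  (\int[P]_w (expR (theta * \sum_(i < m) (f x (z i w) - Ef f mu x)))%:E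
   <= (expR (2 * theta ^+ 2 * (2 * C) ^+ 2) ^+ m)%:E)%E.
Proof.
move=> Xx tC; have := HA2 theta Xx m2 lhs.
rewrite /Phi_L unlock => /le_trans; apply.
have := mgf_le (measurable_msupport mu) mu_supp
   (measurable_funB (f_sec Xx) (measurable_cst (Ef f mu x)))
   (fun y Sy => centered_bound Xx Sy) (integral_centered f_meas f_bnd cX mu_supp Xx) tC.
rewrite /Phi_I EFin_expe.
elim: (m) => // k IHk h; rewrite !expeS lee_pmul//.
- by apply: integral_ge0 => y _; rewrite lee_fin expR_ge0.
- by apply: expe_ge0; apply: integral_ge0 => y _; rewrite lee_fin expR_ge0.
- exact: IHk.
Qed.

(** The comparison of moment generating functions replaces independence in
    Chernoff's bound. *)
Lemma lhs_regular : regular_sample F LatinHypercube m z.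
Proof.
have m0 : (0 < m)%N by exact: leq_trans m2.
split => [i|i w|A i Z FA|A x delta FA Xx d0]; rewrite ?muln1.
- by move=> /(lhs_point invF indep lhs)[].
- by move=> /(lhs_point invF indep lhs)[].
- move=> im mZ; have [_ _ law] := lhs_point invF indep lhs im.
  rewrite indepF//; first by rewrite law.
  by apply: sub_sigma_algebra; exists i => //; exists Z; rewrite ?setTI.
have C20 : 0 < 2 * C by rewrite mulr_gt0.
have mS : measurable_fun setT (fun w => \sum_(i < m) (f x (z i w) - Ef f mu x)).
  apply: measurable_sum => i; apply: measurable_funB => //.
  have [mz Sz _] := lhs_point invF indep lhs (ltn_ord i).
  exact: measurable_f_point.
have t0 := tilt_gt0 C20 d0.
(* theta = +/- tilt gives the upper and the lower tail *)
have key (theta : R) (S : Omega -> R) : measurable_fun [set: Os] (S : Os -> R) ->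
    measurable_fun setT S -> `|theta| = tilt (2 * C) delta ->
    (forall w, theta * (\sum_(i < m) (f x (z i w) - Ef f mu x)) =
       tilt (2 * C) delta * S w) ->
  (P (A `&` [set w | m%:R * delta <= S w]%R) <=
    P A * (expR (- (rate (2 * C) delta * m%:R)))%:E)%E.
  move=> mOs mS' tt SE.
  rewrite indepF//; last first.
    have := mOs measurableT `[m%:R * delta, +oo[%classic (measurable_itv _).
    rewrite setTI; congr (<<s _ >>); apply/seteqP.
    by split => w; rewrite /= in_itv/= andbT.
  rewrite lee_wpmul2l//.
  have tC : `|theta| * (2 * C) <= 1 / 2 by rewrite tt; exact: tilt_half.
  have := lhs_mgf Xx tC; under eq_integral do rewrite SE.
  move=> /(tail_of_mgf (m%:R * delta) mS' t0)/le_trans; apply.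
  rewrite lee_fin -expRM_natl -expRD ler_expR.
  have := tilt_rate C20 d0; have : theta ^+ 2 = tilt (2 * C) delta ^+ 2.
    by rewrite -tt -normrX ger0_norm// sqr_ge0.
  move=> ->; have : 0 < tilt (2 * C) delta * (delta / 4) by rewrite mulr_gt0// divr_gt0.
  have : 0 < m%:R :> R by rewrite ltr0n.
  move: (m%:R : R) (tilt _ _) (rate _ _) => M t r M0 q0 h.
  rewrite (_ : _ + _ = M * (2 * t ^+ 2 * (2 * C) ^+ 2 - t * delta)); last by ring.
  rewrite (_ : - (r * M) = M * (- r)); last by ring.
  rewrite ler_pM2l//; lra.
apply: (two_sided_tail (mF FA) mS m0).
- by move=> w; exact: deviation_lhs.
- apply: (key (tilt (2 * C) delta)) => //; last by rewrite gtr0_norm.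
  exact: measurable_S.
- apply: (key (- tilt (2 * C) delta)) => //.
  + by apply: measurableT_comp => //; exact: measurable_S.
  + exact: measurableT_comp.
  + by rewrite normrN gtr0_norm.
  + by move=> w; rewrite mulNr mulrN.
Qed.

End lhs.

Section av.
Context (F : set (set Omega)) (m : nat) (v z : nat -> Omega -> 'rV[R]_dxi).
Hypothesis invF : forall j, invertible_cdf mu j.
Hypothesis indep : indep_components mu.
Hypothesis cube_v : forall i, uniform_cube P (v i).
Hypothesis m0 : (0 < m)%N.
Hypothesis mF : F `<=` measurable.
Hypothesis indepF : forall A (s : seq nat) (B : nat -> set Omega), F A -> uniq s ->
  (forall i, i \in s -> preimage_set_system setT (v i) measurable (B i)) ->
  P (A `&` \bigcap_(i in [set` s]) B i) = (P A * \prod_(i <- s) P (B i))%E.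
Hypothesis zE : forall i w, (i < m)%N ->
  z i.*2 w = inv_transform mu (v i w) /\
  z i.*2.+1 w = inv_transform mu (mirror (v i w)).

Let measurable_T1 : measurable_fun (@cube R dxi) (inv_transform mu).
Proof. exact: measurable_inv_transform. Qed.

Let measurable_T2 : measurable_fun (@cube R dxi) (inv_transform mu \o @mirror R dxi).
Proof.
apply: (measurable_comp (F := @cube R dxi)) => //.
- exact: measurable_cube.
- by move=> _ [y cy <-]; exact: mirror_cube.
- by apply: measurable_funTS; exact: measurable_mirror.
Qed.

Lemma av_point i : (i < m * 2)%N -> [/\ measurable_fun setT (z i),
  forall w, msupport mu (z i w),
  forall Z, measurable Z -> P (z i @^-1` Z) = mu Z
  & forall Z, measurable Z -> preimage_set_system setT (v i./2) measurable (z i @^-1` Z)].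
Proof.
move=> im; have i2m : (i./2 < m)%N by rewrite ltn_half_double -muln2.
have cv w : cube (v i./2 w) by exact: uniform_cube_cube.
have [T [zT mT ST lawT]] : exists T : 'rV[R]_dxi -> 'rV[R]_dxi,
   [/\ z i = T \o v i./2, measurable_fun (@cube R dxi) T,
       forall y, cube y -> msupport mu (T y)
     & forall Z, measurable Z -> P ((T \o v i./2) @^-1` Z) = mu Z].
  have [oi|ei] := boolP (odd i).
    exists (inv_transform mu \o @mirror R dxi); split => //.
    - apply/funext => w; rewrite -[in z i](odd_double_half i) oi add1n.
      by have [_ ->] := zE w i2m.
    - by move=> y cy; apply: inv_transform_support => //; exact: mirror_cube.
    - by move=> Z mZ; exact: law_antithetic_mirror.
  exists (inv_transform mu); split => //.
  - apply/funext => w; rewrite -[in z i](odd_double_half i) (negbTE ei) add0n.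
    by have [-> _] := zE w i2m.
  - by move=> y cy; exact: inv_transform_support.
  - by move=> Z mZ; exact: law_antithetic.
have [mv _ _] := cube_v i./2.
rewrite zT; split => //.
- apply: (measurable_comp (@measurable_cube R dxi)) => //.
  by move=> _ [w _ <-].
- by move=> w; exact: ST.
- move=> Z mZ; exists (@cube R dxi `&` T @^-1` Z).
    by apply: mT => //; exact: measurable_cube.
  by apply/seteqP; split => w /=; [case=> _ []|move=> h; split].
Qed.

Lemma point_expectation x (y : Omega -> 'rV[R]_dxi) : X x -> measurable_fun setT y ->
  (forall w, msupport mu (y w)) -> (forall Z, measurable Z -> P (y @^-1` Z) = mu Z) ->
  (\int[P]_w (f x (y w))%:E = (Ef f mu x)%:E)%E.
Proof.
move=> Xx my Sy lawy; rewrite (EfE f_meas f_bnd cX mu_supp Xx).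
pose Y : {RV P >-> 'rV[R]_dxi} :=
  MeasurableFun.Pack (MeasurableFun.Class (isMeasurableFun.Build _ _ _ _ _ my)).
pose g := (EFin \o f x) \_ (msupport mu).
have mg : measurable_fun setT g.
  apply/(measurable_restrictT _ _).1; first exact: measurable_msupport.
  by apply/measurable_EFinP; exact: f_sec.
rewrite [RHS]integral_mkcond -/g.
transitivity (\int[distribution P Y]_t g t)%E; last first.
  by apply: eq_measure_integral => A mA _; exact: lawy.
rewrite integral_distribution//.
  by apply: eq_integral => w _; rewrite /= /g patchE mem_set.
rewrite (_ : _ \o _ = EFin \o (fun w => f x (y w))); last first.
  by apply/funext => w; rewrite /= /g patchE mem_set.
apply: measurable_bounded_integrable => //.
- by rewrite [X in (X < _)%E]probability_setT ltry.
- exact: measurable_f_point.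
- exists C; split; first exact: num_real.
  by move=> b Cb w _; exact: le_trans (f_bnd Xx (Sy w)) (ltW Cb).
Qed.

(** The pair averages are independent, bounded, and have mean [Ef f mu x] because
    both members of a pair have law [mu]; so Chernoff's bound applies to them. *)
Lemma av_regular : regular_sample F Antithetic m z.
Proof.
split => [i|i w|A i Z FA|A x delta FA Xx d0]; rewrite ?/(points_per_obs _).
- by move=> /av_point[].
- by move=> /av_point[].
- move=> /av_point[mz Sz lawz prez] mZ.
  have := @indepF A [:: i./2] (fun=> z i @^-1` Z) FA isT.
  rewrite big_seq1 lawz// => <-; last by move=> j; rewrite inE => /eqP ->; exact: prez.
  congr (P (A `&` _)); apply/seteqP; split => w /= h; first by move=> j _.
  by apply: (h i./2); rewrite /= inE.
have C20 : 0 < 2 * C by rewrite mulr_gt0.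
have dbl (i : nat) : (i < m)%N -> (i.*2 < m * 2)%N by rewrite muln2 ltn_double.
have dblS (i : nat) : (i < m)%N -> (i.*2.+1 < m * 2)%N by rewrite muln2 ltn_Sdouble.
pose Y (i : nat) w := obs f Antithetic (fun j => z j w) i x - Ef f mu x.
have mY (i : 'I_m) : measurable_fun setT (Y i).
  have [mz1 Sz1 _ _] := av_point (dbl i (ltn_ord i)).
  have [mz2 Sz2 _ _] := av_point (dblS i (ltn_ord i)).
  apply: measurable_funB => //; apply: measurable_funM => //.
  by apply: measurable_funD; exact: measurable_f_point.
have YB (i : 'I_m) w : `|Y i w| <= 2 * C.
  have [mz1 Sz1 _ _] := av_point (dbl i (ltn_ord i)).
  have [mz2 Sz2 _ _] := av_point (dblS i (ltn_ord i)).
  have := centered_bound Xx (Sz1 w); have := centered_bound Xx (Sz2 w).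
  rewrite /Y /obs !ler_norml => /andP[? ?] /andP[? ?]; apply/andP; split; lra.
have intp (y : Omega -> 'rV[R]_dxi) : measurable_fun setT y ->
    (forall w, msupport mu (y w)) -> P.-integrable setT (EFin \o (fun w => f x (y w))).
  move=> my Sy; apply: measurable_bounded_integrable => //.
  - by rewrite [X in (X < _)%E]probability_setT ltry.
  - exact: measurable_f_point.
  - exists C; split; first exact: num_real.
    by move=> b Cb w _; exact: le_trans (f_bnd Xx (Sy w)) (ltW Cb).
have Y0 (i : 'I_m) : (\int[P]_w (Y i w)%:E = 0)%E.
  have [mz1 Sz1 law1 _] := av_point (dbl i (ltn_ord i)).
  have [mz2 Sz2 law2 _] := av_point (dblS i (ltn_ord i)).
  have i1 := intp _ mz1 Sz1; have i2 := intp _ mz2 Sz2.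
  under eq_integral => w _ do rewrite /Y /obs EFinB EFinM EFinD.
  rewrite integralB//; last 2 first.
  - by apply: integrableZl => //; exact: integrableD.
  - apply: measurable_bounded_integrable => //.
    + by rewrite [X in (X < _)%E]probability_setT ltry.
    + by exists `|Ef f mu x|; split; rewrite ?num_real// => b bE w _; exact: ltW.
  rewrite integralZl//; last exact: integrableD.
  rewrite integralD// !point_expectation// integral_cst//.
  rewrite [X in (_ - _ * X)%E]probability_setT mule1.
  transitivity (2^-1 * (Ef f mu x + Ef f mu x) - Ef f mu x)%:E => //.
  by congr EFin; lra.
have preY (i : 'I_m) S : measurable S ->
    preimage_set_system setT (v i) measurable (Y i @^-1` S).
  move=> mS.
  pose psi y := 2^-1 * (f x (inv_transform mu y) + f x (inv_transform mu (mirror y)))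
    - Ef f mu x.
  have mcomp (T : 'rV[R]_dxi -> 'rV[R]_dxi) : measurable_fun (@cube R dxi) T ->
      (forall y, cube y -> msupport mu (T y)) ->
      measurable_fun (@cube R dxi) (fun y => f x (T y)).
    move=> mT ST; apply: (measurable_comp (F := msupport mu) (f := f x) (g := T)) => //.
    - exact: measurable_msupport.
    - by move=> _ [y cy <-]; exact: ST.
    - exact: f_sec.
  have mpsi : measurable_fun (@cube R dxi) psi.
    apply: measurable_funB => //; apply: measurable_funM => //; apply: measurable_funD.
      by apply: mcomp => // y cy; exact: inv_transform_support.
    apply: mcomp => // y cy; apply: inv_transform_support => //; exact: mirror_cube.
  exists (@cube R dxi `&` psi @^-1` S).
    by apply: mpsi => //; exact: measurable_cube.
  have YE w : Y i w = psi (v i w).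
    by have [h1 h2] := zE w (ltn_ord i); rewrite /Y /obs h1 h2.
  rewrite setTI; apply/seteqP; split => w /=; rewrite YE; first by case.
  by move=> h; split => //; exact: uniform_cube_cube.
(* sg = 1 and sg = -1 serve the two tails *)
have indY (sg : R) (S : 'I_m -> set R) : (forall i, measurable (S i)) ->
     P (A `&` [set w | forall i : 'I_m, S i (sg * Y i w)]) =
     (P A * \prod_(i < m) P ((fun w => (sg * Y i w)%R) @^-1` S i))%E.
  move=> mS.
  pose B (i : nat) : set Omega := if (insub i : option 'I_m) is Some o
    then (fun w => sg * Y o w) @^-1` S o else setT.
  have BE (i : 'I_m) : B i = (fun w => sg * Y i w) @^-1` S i by rewrite /B valK.
  have := @indepF A (index_iota 0 m) B FA (iota_uniq _ _).
  rewrite big_mkord; under eq_bigr do rewrite BE.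
  move=> <-.
    congr (P (A `&` _)); apply/seteqP; split => w /= h.
      move=> i; rewrite /= mem_index_iota => /andP[_ im].
      by rewrite (BE (Ordinal im)); exact: h.
    by move=> i; have := h i; rewrite BE; apply; rewrite /= mem_index_iota ltn_ord.
  move=> i; rewrite mem_index_iota => /andP[_ im]; rewrite (BE (Ordinal im)).
  have mSo : measurable ((fun y => sg * y) @^-1` S (Ordinal im)).
    rewrite -[X in measurable X]setTI.
    by apply: (measurable_funM (measurable_cst sg) (@measurable_id _ _ setT)).
  exact: preY (Ordinal im) _ mSo.
have mS : measurable_fun setT (fun w => \sum_(i < m) Y i w) by exact: measurable_sum.
apply: (two_sided_tail (mF FA) mS m0).
- move=> w; rewrite /deviation /sample_avg /Y sumrB sumr_const card_ord mulrBr.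
  by rewrite -[X in _ - _ * X]mulr_natl mulKf// pnatr_eq0 -lt0n.
- apply: chernoff_indep => //; first exact: mF.
  move=> S mS'; have := indY 1 S mS'.
  under eq_bigr => i _ do under eq_fun do rewrite mul1r.
  by under eq_set do under eq_forall do rewrite mul1r.
- have -> : [set w | m%:R * delta <= - (\sum_(i < m) Y i w)] =
            [set w | m%:R * delta <= \sum_(i < m) (-1) * Y i w].
    by apply/seteqP; split => w /=; rewrite -mulr_sumr mulN1r.
  apply: (chernoff_indep (Y := fun (i : 'I_m) w => (-1) * Y i w)) => //.
  + by move=> i; exact: measurable_funM.
  + by move=> i w; rewrite normrM normrN1 mul1r.
  + move=> i; under eq_integral do rewrite EFinM.
    rewrite integralZl// ?Y0 ?mule0//.
    apply: measurable_bounded_integrable => //.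
    * by rewrite [X in (X < _)%E]probability_setT ltry.
    * exists (2 * C); split; first exact: num_real.
      by move=> b Cb w _; exact: le_trans (YB i w) (ltW Cb).
  + exact: mF.
  + exact: indY.
Qed.

End av.

End regular.

(** * Deviations at random candidates and over the feasible set *)

Section deviations.
Context d (Omega : measurableType d) (R : realType) (P : probability Omega R).
Context (dx dxi : nat) (X : set 'rV[R]_dx) (f : 'rV[R]_dx -> 'rV[R]_dxi -> R)
  (mu : probability 'rV[R]_dxi R) (C : R).
Hypothesis C0 : 0 < C.
Hypothesis f_meas : measurable_fun (X `*` msupport mu) (fun z => f z.1 z.2).
Hypothesis f_cont : {ae mu, forall z, {within X, continuous (f^~ z)}}.
Hypothesis f_bnd : forall x z, X x -> msupport mu z -> `|f x z| <= C.
Hypothesis X0 : X !=set0.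
Hypothesis cX : compact X.
Hypothesis mu_supp : mu (msupport mu) = 1%E.
Context (G : set (set Omega)).
Hypothesis mG : <<s G >> `<=` @measurable _ Omega.

Notation regular := (regular_sample P X f mu C <<s G >>).

(** The set [seqDU A k] consists of those [w] for which [k] is the first index with
    [A k w].  These events are disjoint and known to [<<s G>>], so the conditional
    bounds [eta] average to [eta]: a random index that is independent of the sets
    [D k] costs nothing. *)
Lemma random_index (A D : nat -> set Omega) (eta : R) :
  (forall k, <<s G >> (A k)) -> (forall k, measurable (D k)) ->
  (forall B k, <<s G >> B -> (P (B `&` D k) <= P B * eta%:E)%E) -> 0 <= eta ->
  (P (\bigcup_k (seqDU A k `&` D k)) <= eta%:E)%E.
Proof.
move=> GA mD PD eta0.
have GU k : <<s G >> (seqDU A k).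
  apply: (@measurableD _ (g_sigma_algebraType G)); first exact: GA.
  by apply: (@bigsetU_measurable _ (g_sigma_algebraType G)) => i _; exact: GA.
have mU k : measurable (seqDU A k) by exact: mG.
have mUD k : measurable (seqDU A k `&` D k) by exact: measurableI.
apply: (le_trans (measure_sigma_subadditive P mUD
  (bigcup_measurable (fun k _ => mUD k)) (@subset_refl _ _))).
apply: (@le_trans _ _ (\sum_(0 <= k <oo) (P (seqDU A k) * eta%:E))%E).
  by apply: lee_nneseries => // k _; exact: PD.
rewrite (eq_eseriesr (fun k _ => muleC _ _)) nneseriesZl//.
rewrite -[leRHS]mule1 lee_wpmul2l//.
have -> : (\sum_(0 <= k <oo) P (seqDU A k) = P (\bigcup_k seqDU A k))%E.
  apply: cvg_lim => //; apply: measure_semi_sigma_additive => //.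
  exact: bigcup_measurable.
apply: probability_le1; exact: bigcup_measurable.
Qed.

Section one_sample.
Context (s : method) (m : nat) (z : nat -> Omega -> 'rV[R]_dxi).
Hypothesis m0 : (0 < m)%N.
Hypothesis rz : regular s m z.
Let N := (m * points_per_obs s)%N.

Let N0 : 0 < N%:R :> R.
Proof. by rewrite ltr0n /N muln_gt0 m0/=; case: (s). Qed.

Lemma sum_pairs (g : nat -> R) k :
  \sum_(i < k * 2) g i = \sum_(i < k) (g i.*2 + g i.*2.+1).
Proof.
elim: k => [|k IHk]; first by rewrite mul0n !big_ord0.
by rewrite mulSn !big_ord_recr/= IHk muln2 addrA.
Qed.

Lemma sample_avg_points (pts : nat -> 'rV[R]_dxi) x :
  sample_avg m (obs f s pts) x = N%:R^-1 * \sum_(i < N) f x (pts i).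
Proof.
rewrite /sample_avg /N; case: (s) => /=; last by rewrite muln1.
rewrite (sum_pairs (fun i => f x (pts i))) -mulr_sumr mulrA natrM invfM.
by [].
Qed.

Definition proportion_outside (E : set 'rV[R]_dxi) (w : Omega) : R :=
  N%:R^-1 * \sum_(i < N) \1_(~` E) (z i w).

Lemma measurable_outside E : measurable E -> measurable_fun setT (proportion_outside E).
Proof.
move=> mE; apply: measurable_funM => //; apply: measurable_sum => i.
apply: measurableT_comp; first by apply: measurable_indic; exact: measurableC.
exact: (rs_meas rz).
Qed.

(** Markov's inequality, for the expected proportion [mu (~` E)]. *)
Lemma outside_tail E B (kappa : R) : measurable E -> <<s G >> B -> 0 < kappa ->
  (P (B `&` [set w | kappa <= proportion_outside E w]%R) <=
   P B * ((kappa^-1)%:E * mu (~` E)))%E.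
Proof.
move=> mE GB k0.
have mB := mG GB.
have mEC : measurable (~` E) by exact: measurableC.
have mz i : (i < N)%N -> measurable (z i @^-1` (~` E)).
  by move=> iN; rewrite -[X in measurable X]setTI; exact: (rs_meas rz).
set ev := B `&` _.
have mev : measurable ev.
  apply: measurableI => //.
  by apply: measurable_superlevel; exact: measurable_outside.
have : ((kappa * N%:R)%:E * P ev <= \sum_(i < N) P (B `&` z i @^-1` (~` E)))%E.
  rewrite -(setIT ev) -integral_indic// -ge0_integralZl//; last 2 first.
  - by apply/measurable_EFinP; exact: measurable_indic.
  - by rewrite lee_fin mulr_ge0// ltW.
  rewrite (eq_bigr (fun i : 'I_N =>
      \int[P]_w (\1_(B `&` z i @^-1` (~` E)) w)%:E)%E); last first.
    by move=> i _; rewrite integral_indic ?setIT//; apply: measurableI => //; exact: mz.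
  rewrite -ge0_integral_sum//; last first.
    move=> i; apply/measurable_EFinP; apply: measurable_indic.
    by apply: measurableI => //; exact: mz.
  apply: ge0_le_integral => //.
  - by move=> w _; rewrite mule_ge0// lee_fin// mulr_ge0// ltW.
  - apply: emeasurable_funM => //.
    by apply/measurable_EFinP; exact: measurable_indic.
  - apply: emeasurable_sum => i; apply/measurable_EFinP; apply: measurable_indic.
    by apply: measurableI => //; exact: mz.
  move=> w _; rewrite sumEFin -EFinM lee_fin [\1_ev _]indicE.
  have [evw|nevw] := pselect (ev w); last first.
    by rewrite memNset// mulr0; apply: sumr_ge0.
  rewrite mem_set// mulr1; case: evw => Bw /=; rewrite /proportion_outside mulrC.
  rewrite ler_pdivlMr// => /le_trans; apply; apply: ler_sum => i _.
  rewrite !indicE; case: (boolP (z i w \in ~` E)) => //; rewrite inE => zE.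
  by rewrite mem_set.
rewrite (eq_bigr (fun=> (P B * mu (~` E))%E)); last first.
  by move=> i _; exact: (rs_law rz GB (ltn_ord i) mEC).
rewrite -[P ev]fineK ?fin_num_measure// -[P B]fineK ?fin_num_measure//.
rewrite -[mu _]fineK ?fin_num_measure// -EFinM.
rewrite (eq_bigr (fun=> (fine (P B) * fine (mu (~` E)))%:E)) => [|i _]; last first.
  by rewrite -EFinM.
rewrite sumEFin sumr_const card_ord -!EFinM !lee_fin -[leRHS]mulr_natl.
set p := fine (P ev); set b := fine (P B); set q := fine _ => h.
rewrite mulrCA ler_pdivlMl// -(ler_pM2l N0).
by rewrite (_ : N%:R * (kappa * p) = kappa * N%:R * p); last by ring.
Qed.

Lemma deviation_dist E (delta : R) x y w : X x -> X y -> measurable E -> 0 <= delta ->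
  (forall t, E t -> `|f x t - f y t| <= delta) ->
  `|deviation f mu s m z x w - deviation f mu s m z y w| <=
    2 * delta + 2 * C * proportion_outside E w + 2 * C * fine (mu (~` E)).
Proof.
move=> Xx Xy mE d0 fE.
have h1 : `|Ef f mu x - Ef f mu y| <= delta + 2 * C * fine (mu (~` E)).
  apply: (Ef_dist (G := E) f_meas f_bnd cX mu_supp) => //.
    by rewrite fineK// fin_num_measure//; exact: measurableC.
  by move=> t Et _; exact: fE.
have h2 : `|sample_avg m (obs f s (fun i => z i w)) x
     - sample_avg m (obs f s (fun i => z i w)) y| <=
    delta + 2 * C * proportion_outside E w.
  rewrite !sample_avg_points -mulrBr -sumrB normrM gtr0_norm ?invr_gt0//.
  rewrite /proportion_outside mulrCA -[X in X + _](mulKf (lt0r_neq0 N0) delta) -mulrDr.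
  rewrite ler_pM2l ?invr_gt0//.
  rewrite (le_trans (ler_norm_sum _ _ _))//.
  rewrite (_ : N%:R * delta = \sum_(i < N) delta); last first.
    by rewrite sumr_const card_ord mulr_natl.
  rewrite mulr_sumr -big_split/=.
  apply: ler_sum => i _; rewrite indicE.
  have [Ez|nEz] := pselect (E (z i w)).
    by rewrite memNset ?mulr0 ?addr0; [exact: fE|move/(_ Ez)].
  rewrite mem_set// mulr1 ler_wpDl// (le_trans (ler_normB _ _))//.
  have Sz : msupport mu (z i w) by exact: (rs_supp rz).
  by have := f_bnd Xx Sz; have := f_bnd Xy Sz; lra.
rewrite /deviation.
set a := sample_avg _ _ x in h2 *; set b := sample_avg _ _ y in h2 *.
have -> : a - Ef f mu x - (b - Ef f mu y) = (a - b) - (Ef f mu x - Ef f mu y) by ring.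
by rewrite (le_trans (ler_normB _ _))//; lra.
Qed.

Lemma measurable_observed (Y : Omega -> 'rV[R]_dx) i : (i < N)%N ->
  measurable_fun setT Y -> (forall w, X (Y w)) ->
  measurable_fun setT (fun w => f (Y w) (z i w)).
Proof.
move=> iN mY XY.
apply: (measurable_comp (F := X `*` msupport mu)
  (f := fun t : 'rV[R]_dx * 'rV[R]_dxi => f t.1 t.2) (g := fun w => (Y w, z i w))) => //.
- by apply: measurableX; [exact: measurable_compact|exact: measurable_msupport].
- by move=> _ [w _ <-]; split; [exact: XY|exact: (rs_supp rz)].
- by apply: measurable_fun_pair => //; exact: (rs_meas rz).
Qed.

Lemma measurable_Ef_comp (Y : Omega -> 'rV[R]_dx) :
  measurable_fun setT Y -> (forall w, X (Y w)) ->
  measurable_fun setT (fun w => Ef f mu (Y w)).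
Proof.
move=> mY XY; apply: (measurable_comp (F := X) (f := Ef f mu) (g := Y)) => //.
- exact: measurable_compact.
- by move=> _ [w _ <-].
- exact: (measurable_Ef f_meas f_cont f_bnd X0 cX mu_supp).
Qed.

Notation dev := (deviation f mu s m z).

Lemma measurable_deviation (Y : Omega -> 'rV[R]_dx) :
  measurable_fun setT Y -> (forall w, X (Y w)) ->
  measurable_fun setT (fun w => dev (Y w) w).
Proof.
move=> mY XY; apply: measurable_funB; last exact: measurable_Ef_comp.
under eq_fun do rewrite sample_avg_points.
by apply: measurable_funM => //; apply: measurable_sum => i; exact: measurable_observed.
Qed.

Lemma measurable_deviation_ge x (delta : R) : X x ->
  measurable [set w | delta <= `|dev x w|].
Proof.
move=> Xx; apply: measurable_superlevel; apply: measurableT_comp => //.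
exact: (measurable_deviation (Y := fun=> x)).
Qed.

Lemma measurable_outside_ge E (kappa : R) : measurable E ->
  measurable [set w | kappa <= proportion_outside E w].
Proof. by move=> mE; apply: measurable_superlevel; exact: measurable_outside. Qed.

(** With these constants the four error terms of [deviation_dist] are at most
    [delta / 8] each, which leaves [delta / 2] for the deviation at [y]. *)
Lemma deviation_close E (delta : R) x y w : 0 < delta -> X x -> X y -> measurable E ->
  (forall t, E t -> `|f x t - f y t| <= delta / 8) ->
  (mu (~` E) <= (delta / (16 * C))%:E)%E -> proportion_outside E w <= delta / (16 * C) ->
  `|dev y w| < delta / 2 -> `|dev x w| < delta.
Proof.
move=> d0 Xx Xy mE EP Emu Eout devy.
have d80 : 0 <= delta / 8 by rewrite divr_ge0// ltW.
have := deviation_dist w Xx Xy mE d80 EP.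
have Ck : 2 * C * (delta / (16 * C)) = delta / 8 by field; rewrite gt_eqF.
have C2 : 0 <= 2 * C by rewrite mulr_ge0// ltW.
have h1 : 2 * C * proportion_outside E w <= delta / 8 by rewrite -Ck ler_wpM2l.
have h2 : 2 * C * fine (mu (~` E)) <= delta / 8.
  rewrite -Ck ler_wpM2l// -lee_fin fineK// fin_num_measure//; exact: measurableC.
have := lerB_dist (dev x w) (dev y w).
lra.
Qed.

(** The candidate is replaced by the first point of a dense sequence that is close
    to it.  The index of this point is random but independent of the sample, and
    each point of the sequence has the exponential tail of a fixed [x].  The
    replacement fails when too many sample points are outside a set [E]; since [E]
    may depend on [m], the probability of failure can be made as small as the
    exponential tail, although it is only controlled by Markov's inequality. *)
Lemma random_candidate_tail (Y : Omega -> 'rV[R]_dx) (delta : R) : 0 < delta ->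
  (forall w, X (Y w)) -> (forall Z, measurable Z -> <<s G >> (Y @^-1` Z)) ->
  exists D, [/\ measurable D,
    (P D <= (3 * expR (- (rate (2 * C) (delta / 2) * m%:R)))%:E)%E
    & forall w, ~ D w -> `|dev (Y w) w| < delta].
Proof.
move=> d0 XY GY.
set gam := expR _; have gam0 : 0 < gam by exact: expR_gt0.
pose kappa := delta / (16 * C).
have kappa0 : 0 < kappa by rewrite divr_gt0// mulr_gt0.
have d80 : 0 < delta / 8 by rewrite divr_gt0.
(* the second bound makes Markov's inequality yield gam *)
have kg0 : 0 < Num.min kappa (kappa * gam) by rewrite lt_min kappa0 mulr_gt0.
have [e [E [e0 mE ES Emu EP]]] :=
  equicontinuous_on_large_set f_meas f_cont X0 cX mu_supp d80 kg0.
have [c [Xc dense]] := dense_sequence cX X0.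
pose A i := Y @^-1` [set y | `|y - c i| < e].
pose Dc i := [set w | delta / 2 <= `|dev (c i) w|].
have GA i : <<s G >> (A i).
  apply: GY; apply: measurable_open_rV.
  rewrite (_ : mkset _ = ball (c i) e); first exact: ball_open.
  by rewrite -ball_normE; apply/seteqP; split => y /=; rewrite distrC.
have mDc i : measurable (Dc i) by exact: measurable_deviation_ge.
have d20 : 0 < delta / 2 by rewrite divr_gt0.
have tail := random_index GA mDc (eta := 2 * gam)
  (fun B i GB => rs_tail rz GB (Xc i) d20) (mulr_ge0 (ler0n _ _) (ltW gam0)).
set U := \bigcup_k _ in tail.
have mU : measurable U.
  apply: bigcup_measurable => k _; apply: measurableI => //; apply: mG.
  apply: (@measurableD _ (g_sigma_algebraType G)); first exact: GA.
  by apply: (@bigsetU_measurable _ (g_sigma_algebraType G)) => i _; exact: GA.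
have GT : <<s G >> [set: Omega] := @measurableT _ (g_sigma_algebraType G).
have := outside_tail mE GT kappa0; rewrite setTI; set V := [set w | _] => tailV.
have mV : measurable V by exact: measurable_outside_ge.
exists (V `|` U); split; first exact: measurableU.
  apply: (le_trans (measureU2 _ mV mU)).
  rewrite (_ : 3 * gam = gam + 2 * gam); last by ring.
  rewrite EFinD leeD// (le_trans tailV)// [X in (X * _)%E]probability_setT mul1e.
  apply: (@le_trans _ _ ((kappa^-1)%:E * (kappa * gam)%:E)%E).
    rewrite lee_wpmul2l ?lee_fin ?invr_ge0 ?(ltW kappa0)// (le_trans Emu)//.
    by rewrite lee_fin ge_min lexx orbT.
  by rewrite -EFinM mulKf ?gt_eqF.
move=> w /not_orP[Vw Uw].
have : (\bigcup_k A k) w by have [i ie] := dense (Y w) e (XY w) e0; exists i.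
rewrite seqDU_bigcup_eq => -[k _ Ak].
apply: (deviation_close (E := E) (y := c k)) => //.
- by move=> t Et; apply: EP => //; exact: subset_seqDU Ak.
- by rewrite (le_trans Emu)// lee_fin ge_min lexx.
- by rewrite leNgt; apply/negP => /ltW h; apply: Vw.
- by rewrite ltNge; apply/negP => h; apply: Uw; exists k.
Qed.

End one_sample.

(** A finite net replaces the dense sequence of [random_candidate_tail]: all its
    points have small deviations with high probability once [m] is large. *)
Lemma uniform_deviation (delta eta : R) : 0 < delta -> 0 < eta ->
  exists M : nat, forall s m z, (0 < m)%N -> (M <= m)%N -> regular s m z ->
  exists D, [/\ measurable D,
    forall B, <<s G >> B -> (P (B `&` D) <= P B * eta%:E)%E
    & forall w, ~ D w -> forall x, X x -> `|deviation f mu s m z x w| < delta].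
Proof.
move=> d0 eta0.
pose kappa := delta / (16 * C).
have kappa0 : 0 < kappa by rewrite divr_gt0// mulr_gt0.
have d80 : 0 < delta / 8 by rewrite divr_gt0.
have d20 : 0 < delta / 2 by rewrite divr_gt0.
have eta20 : 0 < eta / 2 by rewrite divr_gt0.
have C20 : 0 < 2 * C by rewrite mulr_gt0.
have kg0 : 0 < Num.min kappa (kappa * (eta / 2)) by rewrite lt_min kappa0 mulr_gt0.
have [e [E [e0 mE ES Emu EP]]] :=
  equicontinuous_on_large_set f_meas f_cont X0 cX mu_supp d80 kg0.
have [c [Xc net]] := finite_net cX e0.
set b := rate (2 * C) (delta / 2).
have b0 : 0 < b by exact: rate_gt0.
pose K := size c.
exists (Num.truncn (4 * K%:R / (eta * b))).+1 => s m z m0 Mm rz.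
have small : 2 * expR (- (b * m%:R)) * K%:R <= eta / 2.
  have : 4 * K%:R / (eta * b) < m%:R.
    by rewrite (lt_le_trans (truncnS_gt _))// ler_nat.
  rewrite ltr_pdivrMr; last by rewrite mulr_gt0.
  move=> h; have mb : 0 <= b * m%:R by rewrite mulr_ge0// ltW.
  have h2 := expR_ge1Dx (b * m%:R).
  rewrite expRN -(ler_pM2r (expR_gt0 (b * m%:R))).
  rewrite (_ : 2 * _ * _ * _ = 2 * K%:R); last first.
    by field; rewrite gt_eqF// expR_gt0.
  rewrite (@le_trans _ _ (eta / 2 * (b * m%:R)))//; last first.
    by rewrite ler_pM2l//; lra.
  by rewrite ltW//; lra.
pose V := [set w | kappa <= proportion_outside s m z E w].
pose Dc (i : 'I_K) := [set w | delta / 2 <= `|deviation f mu s m z (nth 0 c i) w|].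
have Xci (i : 'I_K) : X (nth 0 c i) by apply: Xc; exact: mem_nth.
have mDc i : measurable (Dc i) by exact: measurable_deviation_ge.
have mV : measurable V by exact: (measurable_outside_ge rz).
pose U := \bigcup_(i in [set` xpredT]) Dc i.
have mU : measurable U by exact: measurable_finType_bigcup.
exists (V `|` U); split; first exact: measurableU.
  move=> B GB; have mB := mG GB; rewrite setIUr.
  apply: (le_trans (measureU2 _ (measurableI _ _ mB mV) (measurableI _ _ mB mU))).
  rewrite (splitr eta) EFinD muleDr ?fin_num_measure//.
  apply: leeD.
    apply: (le_trans (outside_tail m0 rz mE GB kappa0)).
    rewrite lee_wpmul2l//.
    apply: (@le_trans _ _ ((kappa^-1)%:E * (kappa * (eta / 2))%:E)%E).
      rewrite lee_wpmul2l ?lee_fin ?invr_ge0 ?(ltW kappa0)// (le_trans Emu)//.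
      by rewrite lee_fin ge_min lexx orbT.
    by rewrite -EFinM mulKf ?gt_eqF.
  apply: (@le_trans _ _ (\sum_(i | xpredT i) P (B `&` Dc i))%E).
    apply: le_measure_finType_bigcup.
    - by move=> i _; exact: measurableI.
    - exact: measurableI.
    - by move=> w [Bw [i _ Di]]; exists i.
  apply: (@le_trans _ _ (\sum_(i < K) (P B * (2 * expR (- (b * m%:R)))%:E))%E).
    by apply: lee_sum => i _; exact: (rs_tail rz).
  rewrite -ge0_sume_distrr; last by move=> i _; rewrite lee_fin mulr_ge0.
  by rewrite lee_wpmul2l// sumEFin lee_fin sumr_const card_ord -[leLHS]mulr_natr.
move=> w /not_orP[Vw Uw] x Xx.
have [y yc xy] := net x Xx.
have ik : (index y c < K)%N by rewrite index_mem.
apply: (deviation_close m0 rz (E := E) (y := y)) => //.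
- exact: Xc.
- by move=> t Et; apply: EP => //; exact: Xc.
- by rewrite (le_trans Emu)// lee_fin ge_min lexx.
- by rewrite leNgt; apply/negP => /ltW h; apply: Vw.
- rewrite ltNge; apply/negP => h; apply: Uw; exists (Ordinal ik) => //.
  by rewrite /Dc/= nth_index.
Qed.

End deviations.

(** * Stopping rule and gap estimators *)

Section stopping_rule.
Context (R : realType) (Omega : Type) (h' eps' : R) (gap sv : nat -> Omega -> R).

Definition stops (k : nat) (w : Omega) : Prop :=
  (0 < k)%N /\ gap k w <= h' * Num.sqrt (sv k w) + eps'.

Lemma stopping_time_first k w : stops k w -> (forall j, (j < k)%N -> ~ stops j w) ->
  stopping_time h' eps' gap sv w = k%:R%:E.
Proof.
move=> sk minj; apply/eqP; rewrite eq_le; apply/andP; split.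
  by apply: ereal_inf_lbound; exists k.
apply: le_ereal_inf_tmp => _ [j sj <-]; rewrite lee_fin ler_nat leqNgt.
by apply/negP => /minj; apply.
Qed.

Lemma first_stop w : (exists k, stops k w) ->
  exists k, stops k w /\ forall j, (j < k)%N -> ~ stops j w.
Proof.
move=> [k0 sk0]; have ex : exists k, `[< stops k w >] by exists k0; apply/asboolP.
have [k /asboolP sk kmin] := ex_minnP ex; exists k; split => // j jk sj.
by have := kmin j; rewrite leqNgt jk => /(_ (asboolT sj)).
Qed.

Lemma stopping_time_finite w :
  (stopping_time h' eps' gap sv w < +oo)%E <-> exists k, stops k w.
Proof.
split=> [Too|/first_stop[k [sk kmin]]]; last first.
  by rewrite (stopping_time_first sk kmin) ltry.
apply: contrapT => nk; move: Too; rewrite /stopping_time.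
rewrite (_ : [set _ | _ in _] = set0) ?ereal_inf0 ?ltxx//.
by apply/seteqP; split => // y [k sk _]; apply: nk; exists k.
Qed.

Lemma stopping_time_eq k w : stopping_time h' eps' gap sv w = k%:R%:E <->
  stops k w /\ forall j, (j < k)%N -> ~ stops j w.
Proof.
split=> [Tk|[sk kmin]]; last exact: stopping_time_first.
have /stopping_time_finite/first_stop[j [sj jmin]] :
    (stopping_time h' eps' gap sv w < +oo)%E by rewrite Tk ltry.
move: (stopping_time_first sj jmin); rewrite Tk => -[/eqP].
by rewrite eqr_nat => /eqP ->.
Qed.

End stopping_rule.

Section sums.
Context (R : realType).

(** Comparison with the telescoping sum of the [2 / (k (k + 1))]. *)
Lemma sum_inv_squares n : \sum_(k < n.+1) (k%:R ^+ 2)^-1 <= 2 - 2 / n.+1%:R :> R.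
Proof.
elim: n => [|n IHn]; first by rewrite big_ord1 expr0n invr0 divr1 subrr.
rewrite big_ord_recr/= (le_trans (lerD IHn (lexx _)))//.
rewrite -[n.+2%:R]natr1; set x : R := n.+1%:R.
have x0 : 0 < x by rewrite ltr0n.
have x1 : 1 <= x by rewrite ler1n.
have -> : 2 - 2 / (x + 1) = 2 - 2 / x + 2 / (x * (x + 1)).
  by field; rewrite !gt_eqF// addr_gt0.
rewrite lerD2l ler_pdivlMr ?mulr_gt0 ?addr_gt0// mulrC ler_pdivrMr ?exprn_gt0//.
nra.
Qed.

Lemma nneseries_inv_squares (c : R) : 0 <= c ->
  (\sum_(k <oo) (c * (k%:R ^+ 2)^-1)%:E <= (2 * c)%:E)%E.
Proof.
move=> c0; apply: lime_le.
  by apply: is_cvg_nneseries => k _ _; rewrite lee_fin mulr_ge0// invr_ge0 exprn_ge0.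
apply: nearW => n; rewrite sumEFin lee_fin -mulr_sumr mulrC ler_wpM2r//.
case: n => [|n]; first by rewrite big_geq.
rewrite big_mkord (le_trans (sum_inv_squares n))// gerBl divr_ge0//.
Qed.

(** With [t] the logarithm, half of [a] is kept and the rest satisfies
    [a / 2 + 2 a p t^2 >= 1 + t^2 >= 2 t]. *)
Lemma exp_log_sq_bound (a p : R) k : (0 < k)%N -> 2 <= a -> 0 < p -> 1 <= 2 * (a * p) ->
  expR (- (a * (1 + 2 * p * ln k%:R ^+ 2))) <= expR (- (a / 2)) * (k%:R ^+ 2)^-1.
Proof.
move=> k0 a2 p0 ap.
have k0' : 0 < k%:R :> R by rewrite ltr0n.
rewrite -{2}(lnK k0') -expRM_natl -expRN -expRD ler_expR.
set t := ln k%:R.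
have : t ^+ 2 <= 2 * (a * p) * t ^+ 2 by rewrite ler_peMl// sqr_ge0.
have := sqr_ge0 (t - 1); nra.
Qed.

End sums.

Section optimality.
Context (R : realType) (dx dxi : nat) (X : set 'rV[R]_dx)
  (f : 'rV[R]_dx -> 'rV[R]_dxi -> R) (mu : probability 'rV[R]_dxi R).

Lemma zstarE y : Xstar X f mu y -> zstar X f mu = Ef f mu y.
Proof.
move=> [Xy ymin]; apply/eqP; rewrite eq_le; apply/andP; split.
  by apply: ge_inf; [exists (Ef f mu y) => _ [t Xt <-]; exact: ymin|exists y].
apply: lb_le_inf; first by exists (Ef f mu y); exists y.
by move=> _ [t Xt <-]; exact: ymin.
Qed.

Section gap.
Context (s : method) (a : assessment) (N : nat)
  (pts : 'I_(nrep a) -> nat -> 'rV[R]_dxi) (x : 'rV[R]_dx)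
  (xopt : 'I_(nrep a) -> 'rV[R]_dx) (delta : R).
Let m := nobs s a N.
Let avg r := sample_avg m (obs f s (pts r)).

Lemma GAPE : GAP f s N pts x xopt =
  (nrep a)%:R^-1 * \sum_(r < nrep a) (avg r x - avg r (xopt r)).
Proof.
by rewrite /GAP; congr (_ * _); apply: eq_bigr => r _; rewrite /srp_gap sumrB mulrBr.
Qed.

Let nrep0 : 0 < (nrep a)%:R :> R.
Proof. by case: (a). Qed.

(** The sample minimisers are feasible, so their expected values are at least
    [zstar]. *)
Lemma GAP_le y : Xstar X f mu y -> (forall r, X (xopt r)) ->
  (forall r, `|avg r x - Ef f mu x| < delta) ->
  (forall r, `|avg r (xopt r) - Ef f mu (xopt r)| < delta) ->
  GAP f s N pts x xopt <= opt_gap X f mu x + 2 * delta.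
Proof.
move=> Xy Xo dx1 dx2; rewrite GAPE mulrC ler_pdivrMr//.
rewrite mulr_natr -[X in _ *+ X]card_ord -sumr_const; apply: ler_sum => r _.
have [_ ymin] := Xy; have := ymin _ (Xo r); rewrite /opt_gap (zstarE Xy).
have := dx1 r; have := dx2 r; rewrite !ltr_norml => /andP[? ?] /andP[? ?]; lra.
Qed.

(** The sample minimisers have a smaller average than the optimal solution [y],
    so putting [y] in their place decreases the estimate. *)
Lemma GAP_ge y : Xstar X f mu y -> (forall r, avg r (xopt r) <= avg r y) ->
  (forall r, `|avg r x - Ef f mu x| < delta) ->
  (forall r, `|avg r y - Ef f mu y| < delta) ->
  opt_gap X f mu x - 2 * delta <= GAP f s N pts x xopt.
Proof.
move=> Xy opt dx1 dx2; rewrite GAPE [leRHS]mulrC ler_pdivlMr//.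
rewrite mulr_natr -[X in _ *+ X]card_ord -sumr_const; apply: ler_sum => r _.
have := opt r; rewrite /opt_gap (zstarE Xy).
have := dx1 r; have := dx2 r; rewrite !ltr_norml => /andP[? ?] /andP[? ?]; lra.
Qed.

End gap.
End optimality.

(** * Regularity of the two sampling methods *)

Section sampling_regular.
Context d (Omega : measurableType d) (R : realType) (P : probability Omega R).
Context (dx dxi : nat) (X : set 'rV[R]_dx) (f : 'rV[R]_dx -> 'rV[R]_dxi -> R)
  (mu : probability 'rV[R]_dxi R) (s : method) (a : assessment)
  (n : nat -> nat) (x : nat -> Omega -> 'rV[R]_dx)
  (xi : nat -> 'I_(nrep a) -> nat -> Omega -> 'rV[R]_dxi).
Hypothesis invF : forall j, invertible_cdf mu j.
Hypothesis indep : indep_components mu.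
Hypothesis samp : sampling P mu s n x xi.

Definition candidate_system : set (set Omega) :=
  \bigcup_(k in [set k | (0 < k)%N]) preimage_set_system setT (x k) measurable.

(** Sample points have law [mu] and lie surely in its support. *)
Lemma sampling_support k (r : 'I_(nrep a)) : (0 < k)%N -> (0 < nobs s a (n k))%N ->
  mu (msupport mu) = 1%E.
Proof.
move=> k0; case: (s) samp => /= [[u [fresh [cu _ xiE]]] m0|[lhs _]].
  rewrite -(law_antithetic (cu r 0%N) invF indep (measurable_msupport mu)).
  rewrite -(@probability_setT _ _ _ P); apply: (congr1 P); apply/seteqP; split => // w _.
  apply: inv_transform_support => //; exact: uniform_cube_cube.
rewrite /nobs divn1 => m0.
have [_ supp law] := lhs_point invF indep (lhs k r k0) m0.
rewrite -(law _ (measurable_msupport mu)).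
rewrite -(@probability_setT _ _ _ P); apply: (congr1 P); apply/seteqP; split => // w _.
exact: supp.
Qed.

Context (C : R).
Hypothesis C0 : 0 < C.
Hypothesis f_meas : measurable_fun (X `*` msupport mu) (fun z => f z.1 z.2).
Hypothesis f_bnd : forall x z, X x -> msupport mu z -> `|f x z| <= C.
Hypothesis cX : compact X.
Hypothesis mu_supp : mu (msupport mu) = 1%E.
Hypothesis mG : <<s candidate_system >> `<=` @measurable _ Omega.
Hypothesis HA2 : s = LatinHypercube -> A2_LHS P mu f X.

Lemma sampling_is_regular k (r : 'I_(nrep a)) : (0 < k)%N -> (2 <= nobs s a (n k))%N ->
  regular_sample P X f mu C <<s candidate_system >> s (nobs s a (n k)) (xi k r).
Proof.
move=> k0; case: (s) samp HA2 => /= [[u [fresh [cu indu xiE]]] _ m2|[lhs indl] A2].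
  (* iteration k uses a segment of the stream of pairs, from index st on *)
  set st := av_start fresh (fun l => nobs Antithetic a (n l)) k in xiE *.
  apply: (av_regular C0 f_meas f_bnd cX mu_supp (v := fun i => u r (st + i)%N)) => //.
  - exact: leq_trans m2.
  - move=> A t B GA ut BP.
    pose W (q : option ('I_(nrep a) * nat)) : set Omega :=
      if q is Some ri then B (ri.2 - st)%N else A.
    have := indu (None :: [seq Some (r, (st + i)%N) | i <- t]) W.
    rewrite big_cons big_map/=.
    under eq_bigr do rewrite addKn.
    move=> <-.
    + apply: (congr1 P); apply/seteqP; split => w /=.
        move=> [Aw Bw] q /=; rewrite inE => /orP[/eqP ->//|/mapP[i it ->]].
        by rewrite /W/= addKn; exact: Bw.
      move=> h; split; first by apply: (h None); rewrite /= inE.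
      move=> i it; have := h (Some (r, (st + i)%N)); rewrite /W/= addKn; apply.
      by rewrite inE/=; apply/mapP; exists i.
    + apply/andP; split; first by apply/mapP => -[].
      by rewrite map_inj_uniq// => i j [] /addnI.
    + by [].
    + move=> q; rewrite inE => /orP[/eqP ->//|/mapP[i it ->]].
      by rewrite /W/= addKn; exact: BP.
  - by move=> i w im; exact: xiE.
rewrite /nobs divn1 => m2.
apply: (lhs_regular C0 f_meas f_bnd cX mu_supp invF indep (A2 erefl)) => //.
- exact: lhs.
- move=> A B GA GB.
  pose W (q : option (nat * 'I_(nrep a))) : set Omega := if q is Some _ then B else A.
  have := indl [:: None; Some (k, r)] W.
  rewrite !big_cons big_nil mule1 => <-//.
  + apply: (congr1 P); apply/seteqP; split => w /=.
      by move=> [Aw Bw] q /=; rewrite !inE => /orP[]/eqP ->.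
    by move=> h; split; [apply: (h None)|apply: (h (Some (k, r)))];
      rewrite /= !inE eqxx ?orbT.
  + by move=> q; rewrite !inE => /orP[]/eqP ->.
  + by move=> q; rewrite !inE => /orP[]/eqP ->.
Qed.

End sampling_regular.

Section measurability.
Context d (Omega : measurableType d) (R : realType) (P : probability Omega R).
Context (dx dxi : nat) (X : set 'rV[R]_dx) (f : 'rV[R]_dx -> 'rV[R]_dxi -> R)
  (mu : probability 'rV[R]_dxi R) (C : R) (G : set (set Omega)) (s : method).
Hypothesis f_meas : measurable_fun (X `*` msupport mu) (fun z => f z.1 z.2).
Hypothesis cX : compact X.

Lemma measurable_obs m z (Y : Omega -> 'rV[R]_dx) i :
  regular_sample P X f mu C <<s G >> s m z -> (i < m)%N ->
  measurable_fun setT Y -> (forall w, X (Y w)) ->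
  measurable_fun setT (fun w => obs f s (fun j => z j w) i (Y w)).
Proof.
move=> rz im mY XY.
have mo j : (j < m * points_per_obs s)%N ->
    measurable_fun setT (fun w => f (Y w) (z j w)).
  by move=> jm; exact: (measurable_observed f_meas cX rz jm mY XY).
rewrite /obs; case: (s) mo => /= mo; last by apply: mo; rewrite muln1.
apply: measurable_funM => //; apply: measurable_funD; apply: mo.
  by rewrite muln2 ltn_double.
by rewrite muln2 ltn_Sdouble.
Qed.

Context (a : assessment) (N : nat) (xi : 'I_(nrep a) -> nat -> Omega -> 'rV[R]_dxi)
  (x : Omega -> 'rV[R]_dx) (xopt : 'I_(nrep a) -> Omega -> 'rV[R]_dx).
Hypothesis rz : forall r, regular_sample P X f mu C <<s G >> s (nobs s a N) (xi r).
Hypothesis mx : measurable_fun setT x.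
Hypothesis Xx : forall w, X (x w).
Hypothesis mxo : forall r, measurable_fun setT (xopt r).
Hypothesis Xxo : forall r w, X (xopt r w).

Let measurable_srp_gap r : measurable_fun setT (fun w =>
  srp_gap (nobs s a N) (obs f s (fun i => xi r i w)) (x w) (xopt r w)).
Proof.
apply: measurable_funM => //; apply: measurable_sum => i.
by apply: measurable_funB; exact: (measurable_obs (rz r)).
Qed.

Lemma measurable_GAP : measurable_fun setT (fun w =>
  GAP f s N (fun r i => xi r i w) (x w) (fun r => xopt r w)).
Proof. by apply: measurable_funM => //; apply: measurable_sum => r. Qed.

Lemma measurable_SV : measurable_fun setT (fun w =>
  SV f s N (fun r i => xi r i w) (x w) (fun r => xopt r w)).
Proof.
apply: measurable_funM => //; apply: measurable_sum => r.
apply: measurable_funM => //; apply: measurable_sum => i.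
apply: measurable_funX; apply: measurable_funB => //.
by apply: measurable_funB; exact: (measurable_obs (rz r)).
Qed.

End measurability.

(** * One run of the sequential procedure *)

Section procedure.
Context d (Omega : measurableType d) (R : realType) (P : probability Omega R).
Context (dx dxi : nat) (X : set 'rV[R]_dx) (f : 'rV[R]_dx -> 'rV[R]_dxi -> R)
  (mu : probability 'rV[R]_dxi R) (s : method) (a : assessment)
  (n : nat -> nat) (x : nat -> Omega -> 'rV[R]_dx)
  (xi : nat -> 'I_(nrep a) -> nat -> Omega -> 'rV[R]_dxi)
  (xopt : nat -> 'I_(nrep a) -> Omega -> 'rV[R]_dx) (C h h' eps eps' : R).
Hypothesis C0 : 0 < C.
Hypothesis f_meas : measurable_fun (X `*` msupport mu) (fun z => f z.1 z.2).
Hypothesis f_cont : {ae mu, forall z, {within X, continuous (f^~ z)}}.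
Hypothesis f_bnd : forall x z, X x -> msupport mu z -> `|f x z| <= C.
Hypothesis X0 : X !=set0.
Hypothesis cX : compact X.
Hypothesis invF : forall j, invertible_cdf mu j.
Hypothesis indep : indep_components mu.
Hypothesis samp : sampling P mu s n x xi.
Hypothesis HA2 : s = LatinHypercube -> A2_LHS P mu f X.
Hypothesis x_rv : forall k, (0 < k)%N -> measurable_fun setT (x k) /\ forall w, X (x k w).
Hypothesis HA1 : {ae P, forall w, exists2 y, Xstar X f mu y & cluster (x^~ w @ \oo) y}.
Hypothesis m2 : forall k, (0 < k)%N -> (2 <= nobs s a (n k))%N.
Hypothesis m_grows : forall M, exists K, forall k, (K <= k)%N -> (0 < k)%N ->
  (M <= nobs s a (n k))%N.
Hypothesis xopt_rv : forall k r, (0 < k)%N ->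
  measurable_fun setT (xopt k r) /\ forall w, X (xopt k r w).
Hypothesis xopt_opt : forall k r, (0 < k)%N -> {ae P, forall w, forall y, X y ->
  let avg := sample_avg (nobs s a (n k)) (obs f s (fun i => xi k r i w)) in
  avg (xopt k r w) <= avg y}.
Hypothesis h'_gt0 : 0 < h'.

Let gap k w := GAP f s (n k) (fun r i => xi k r i w) (x k w) (fun r => xopt k r w).
Let sv k w := SV f s (n k) (fun r i => xi k r i w) (x k w) (fun r => xopt k r w).
Let stop := stops h' eps' gap sv.
Let dev k r := deviation f mu s (nobs s a (n k)) (xi k r).
Let G := candidate_system x.

Let r0 : 'I_(nrep a).
Proof. by case: (a); exact: ord0. Qed.

Let mu_supp : mu (msupport mu) = 1%E.
Proof.
apply: (sampling_support invF indep samp r0 (k := 1%N)) => //.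
exact: leq_trans (m2 _).
Qed.

Let mG : <<s G >> `<=` @measurable _ Omega.
Proof.
apply: smallest_sub; first exact: sigma_algebra_measurable.
move=> _ [k /= k0 [Z mZ <-]]; have [mx _] := x_rv k0; exact: mx.
Qed.

Let regular k r : (0 < k)%N ->
  regular_sample P X f mu C <<s G >> s (nobs s a (n k)) (xi k r).
Proof. move=> k0; apply: sampling_is_regular => //; exact: m2. Qed.

Let Xk k w : (0 < k)%N -> X (x k w). Proof. by move=> /x_rv[]. Qed.
Let Xo k r w : (0 < k)%N -> X (xopt k r w). Proof. by move=> /(xopt_rv r)[]. Qed.

Let m0 k : (0 < k)%N -> (0 < nobs s a (n k))%N.
Proof. by move=> /m2; exact: leq_trans. Qed.

Let candidate_event k Z : (0 < k)%N -> measurable Z -> <<s G >> (x k @^-1` Z).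
Proof.
move=> k0 mZ; apply: sub_sigma_algebra; exists k => //.
by exists Z => //; rewrite setTI.
Qed.

Let measurable_sv k : (0 < k)%N -> measurable_fun setT (sv k).
Proof.
move=> k0; apply: (measurable_SV f_meas cX (fun r => regular r k0)).
- by have [] := x_rv k0.
- by move=> w; exact: Xk.
- by move=> r; have [] := xopt_rv r k0.
- by move=> r w; exact: Xo.
Qed.

Let measurable_threshold k (c e : R) : (0 < k)%N ->
  measurable_fun setT (fun w => c * Num.sqrt (sv k w) + e).
Proof.
move=> k0; apply: measurable_funD => //; apply: measurable_funM => //.
apply: measurableT_comp; last exact: measurable_sv.
exact: (continuous_measurable_fun (@sqrt_continuous R)).
Qed.

Let measurable_le (u v : Omega -> R) : measurable_fun setT u -> measurable_fun setT v ->
  measurable [set w | u w <= v w].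
Proof.
move=> mu_ mv; rewrite (_ : mkset _ = [set w | 0 <= v w - u w]).
  by apply: measurable_superlevel; exact: measurable_funB.
by apply/seteqP; split => w /=; rewrite subr_ge0.
Qed.

Let measurable_stop k : measurable [set w | stop k w].
Proof.
case: (posnP k) => [->|k0].
  by rewrite (_ : mkset _ = set0)//; apply/seteqP; split => // w [].
rewrite (_ : mkset _ = [set w | gap k w <= h' * Num.sqrt (sv k w) + eps']).
  apply: measurable_le; last exact: measurable_threshold.
  apply: (measurable_GAP f_meas cX (fun r => regular r k0)).
  - by have [] := x_rv k0.
  - by move=> w; exact: Xk.
  - by move=> r; have [] := xopt_rv r k0.
  - by move=> r w; exact: Xo.
by apply/seteqP; split => w; [case|move=> ?; split].
Qed.

Let W := [set w | exists k, stop k w].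

Let measurable_W : measurable W.
Proof.
rewrite (_ : W = \bigcup_k [set w | stop k w]).
  exact: bigcupT_measurable.
by apply/seteqP; split => w [k]; [exists k|move=> _ ?; exists k].
Qed.

Let gap_dev k w : (0 < k)%N -> forall delta y, Xstar X f mu y ->
  (forall r z, X z -> `|dev k r z w| < delta) ->
  gap k w <= opt_gap X f mu (x k w) + 2 * delta.
Proof.
move=> k0 delta y Xy devk; apply: (GAP_le Xy) => r; first exact: Xo.
  exact: devk (Xk w k0).
exact: devk (Xo r w k0).
Qed.

(** Let [k] be the first index from [K] on whose candidate is [eps' / 3]-optimal.  It
    is determined by the candidates, so with high probability all the deviations
    of the sample of that iteration are below [eps' / 3] too; then the estimated
    gap is below [eps'] and the rule is satisfied. *)
Lemma not_stopped_le (eta : R) : 0 < eps' -> 0 < eta -> (P (~` W) <= eta%:E)%E.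
Proof.
move=> e0 eta0; have d0 : 0 < eps' / 3 by rewrite divr_gt0.
have eta20 : 0 < eta / 2 by rewrite divr_gt0.
have [M MP] := uniform_deviation P C0 f_meas f_cont f_bnd X0 cX mu_supp mG d0 eta20.
have [K KP] := m_grows M.
have [N [mN N0 NP]] := HA1.
have mEf := measurable_Ef f_meas f_cont f_bnd X0 cX mu_supp.
pose Z := X `&` (Ef f mu) @^-1` `]-oo, zstar X f mu + eps' / 3[%classic.
have mZ : measurable Z by apply: mEf; [exact: measurable_compact|exact: measurable_itv].
pose A k := if (K <= k)%N && (0 < k)%N then x k @^-1` Z else set0.
have GA k : <<s G >> (A k).
  rewrite /A; case: ifPn => [/andP[_ k0]|_]; first exact: candidate_event.
  exact: (@measurable0 _ (g_sigma_algebraType G)).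
have exD k : exists D, [/\ measurable D,
    forall B, <<s G >> B -> (P (B `&` D) <= P B * eta%:E)%E
  & (K <= k)%N -> (0 < k)%N -> forall w, ~ D w -> forall r z, X z ->
      `|dev k r z w| < eps' / 3].
  have [/andP[Kk k0]|kK] := boolP ((K <= k)%N && (0 < k)%N); last first.
    exists set0; split => //; last by move=> Kk k0; rewrite Kk k0 in kK.
    by move=> B GB; rewrite setI0 measure0 mule_ge0// lee_fin ltW.
  have [D DP] := choice (fun r => MP _ _ _ (m0 k0) (KP k Kk k0) (regular r k0)).
  have mD r : measurable (D r) by have [] := DP r.
  exists (\bigcup_(r in [set` xpredT]) D r); split.
  - exact: measurable_finType_bigcup.
  - move=> B GB; have mB := mG GB.
    apply: (@le_trans _ _ (\sum_(r | xpredT r) P (B `&` D r))%E).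
      apply: le_measure_finType_bigcup.
      + by move=> r _; exact: measurableI.
      + by apply: measurableI => //; exact: measurable_finType_bigcup.
      + by move=> w [Bw [r _ Dr]]; exists r.
    apply: (@le_trans _ _ (\sum_(r < nrep a) (P B * (eta / 2)%:E))%E).
      by apply: lee_sum => r _; have [_ + _] := DP r; exact.
    rewrite -ge0_sume_distrr; last by move=> r _; rewrite lee_fin ltW.
    rewrite lee_wpmul2l// sumEFin lee_fin sumr_const card_ord.
    by case: (a) => /=; rewrite -[leLHS]mulr_natl; lra.
  - move=> _ _ w Dw r z Xz; have [_ _] := DP r; apply => // Drw.
    by apply: Dw; exists r.
have [D DP] := choice exD.
have mD k : measurable (D k) by have [] := DP k.
have tail := random_index mG GA mD
  (fun B k GB => (let: And3 _ h _ := DP k in h) B GB) (ltW eta0).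
set U := \bigcup_k _ in tail.
have mU : measurable U.
  apply: bigcup_measurable => k _; apply: measurableI => //; apply: mG.
  apply: (@measurableD _ (g_sigma_algebraType G)); first exact: GA.
  by apply: (@bigsetU_measurable _ (g_sigma_algebraType G)) => i _; exact: GA.
apply: (@le_trans _ _ (P (N `|` U))).
  apply: le_measure; rewrite ?inE; [exact: measurableC|exact: measurableU|].
  move=> w nWw; apply: contrapT => /not_orP[nN nU]; apply: nWw.
  have [y Xy cly] : exists2 y, Xstar X f mu y & cluster (x^~ w @ \oo) y.
    by apply: contrapT => ny; apply: nN; exact: NP.
  have d20 : 0 < eps' / 3 / 2 by rewrite divr_gt0.
  have [e ee eP] := Ef_uniformly_continuous f_meas f_cont f_bnd X0 cX mu_supp d20.
  have [_ [[k [Kk k0] <-] yk]] :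
      [set x k w | k in [set k | (K <= k)%N /\ (0 < k)%N]] `&` ball y e !=set0.
    apply: cly; last exact: nbhsx_ballx.
    exists (maxn K 1) => // k /=; rewrite geq_max => /andP[Kk k0].
    by exists k.
  have : (\bigcup_k A k) w.
    exists k => //; rewrite /A Kk k0/=; split; first exact: Xk.
    rewrite /= in_itv/= (zstarE Xy).
    have [Xy' _] := Xy.
    have := eP (x k w) y (Xk w k0) Xy'.
    rewrite -ball_normE /ball_/= distrC in yk => /(_ yk).
    rewrite ler_norml => /andP[_]; lra.
  rewrite seqDU_bigcup_eq => -[j _ Aj].
  have : A j w := subset_seqDU Aj.
  rewrite /A; case: ifPn => // /andP[Kj j0] [Xj]; rewrite /= in_itv/= => Ej.
  exists j; split => //.
  have [_ _ /(_ Kj j0 w) devj] := DP j.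
  have nDj : ~ D j w by move=> Dj; apply: nU; exists j.
  have := gap_dev j0 Xy (devj nDj).
  move=> /le_trans; apply; rewrite /opt_gap.
  have : 0 <= h' * Num.sqrt (sv j w) by rewrite mulr_ge0 ?sqrtr_ge0// ltW.
  lra.
apply: (le_trans (measureU2 _ mN mU)).
by rewrite [X in (X + _)%E]N0 add0e.
Qed.

Lemma terminates : 0 < eps' -> P W = 1%E.
Proof.
move=> e0; have nW0 : P (~` W) = 0%E.
  apply/eqP; rewrite eq_le measure_ge0 andbT; apply/lee_addgt0Pr => e ee.
  by rewrite add0e; exact: not_stopped_le.
by have := probability_setC P measurable_W; rewrite nW0; move/esym/eqP;
  rewrite sube_eq// ?fin_num_measure// add0e => /eqP.
Qed.

(** Outside the exceptional sets [D k], whose total probability is at most [alpha],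
    the sample averages of iteration [k] at the candidate and at the optimal
    solution [y] are within [delta = (eps - eps') / 2] of their means, so that
    stopping at [k] implies the claimed bound on the optimality gap. *)
Lemma coverage (alpha : R) : 0 < eps' -> eps' < eps -> h' <= h -> 0 < alpha ->
  (forall k, (0 < k)%N ->
     expR (- (rate (2 * C) ((eps - eps') / 4) * (nobs s a (n k))%:R)) <=
     alpha / 24 * (k%:R ^+ 2)^-1) ->
  ((1 - alpha)%:E <= P [set w | exists2 k : nat,
     stopping_time h' eps' gap sv w = k%:R%:E &
     opt_gap X f mu (x k w) <= h * Num.sqrt (sv k w) + eps]%R)%E.
Proof.
move=> e0 ee hh al0 small.
have [N [mN N0 NP]] := HA1.
have [y Xy] : exists y, Xstar X f mu y.
  apply: contrapT => ny; have : P setT = 0%E.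
    apply: (subset_measure0 (B := N)) => // w _; apply: NP => -[y Xy _].
    by apply: ny; exists y.
  by rewrite probability_setT => /eqP; rewrite onee_eq0.
have Xy' : X y by case: Xy.
pose delta := (eps - eps') / 2.
have d0 : 0 < delta by rewrite divr_gt0// subr_gt0.
have dE : delta / 2 = (eps - eps') / 4 by rewrite /delta; field.
pose avg k r w := sample_avg (nobs s a (n k)) (obs f s (fun i => xi k r i w)).
have exD1 k r : (0 < k)%N -> exists D, [/\ measurable D,
    (P D <= (alpha / 4 * (k%:R ^+ 2)^-1)%:E)%E
  & forall w, ~ D w -> [/\ avg k r w (xopt k r w) <= avg k r w y,
      `|dev k r (x k w) w| < delta & `|dev k r y w| < delta]].
  move=> k0.
  (* deviation at the candidate, deviation at y, failure of optimality *)
  have [D1 [mD1 PD1 D1P]] := random_candidate_tail C0 f_meas f_cont f_bnd X0 cX mu_supp mG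
    (m0 k0) (regular r k0) d0 (fun w => Xk w k0) (fun Z mZ => candidate_event k0 mZ).
  have GcstP Z : measurable Z -> <<s G >> ((fun=> y) @^-1` Z : set Omega).
    move=> mZ; rewrite preimage_cst; case: ifP => _.
      exact: (@measurableT _ (g_sigma_algebraType G)).
    exact: (@measurable0 _ (g_sigma_algebraType G)).
  have [D2 [mD2 PD2 D2P]] := random_candidate_tail C0 f_meas f_cont f_bnd X0 cX mu_supp mG
    (m0 k0) (regular r k0) d0 (fun w => Xy') GcstP.
  have [N' [mN' N'0 N'P]] := xopt_opt r k0.
  exists (D1 `|` D2 `|` N'); split.
  - by apply: measurableU => //; exact: measurableU.
  - apply: (le_trans (measureU2 _ (measurableU _ _ mD1 mD2) mN')).
    rewrite [X in (_ + X)%E]N'0 adde0 (le_trans (measureU2 _ mD1 mD2))//.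
    apply: (le_trans (leeD PD1 PD2)).
    by rewrite -EFinD lee_fin dE; have := small k k0; lra.
  - move=> w /not_orP[/not_orP[nD1 nD2] nN']; split; [|exact: D1P|exact: D2P].
    have : forall y, X y ->
        let avg := sample_avg (nobs s a (n k)) (obs f s (fun i => xi k r i w)) in
        avg (xopt k r w) <= avg y.
      by apply: contrapT => nopt; apply: nN'; exact: N'P.
    by move=> /(_ y Xy').
have exD k : exists D, [/\ measurable D,
    (P D <= (alpha / 2 * (k%:R ^+ 2)^-1)%:E)%E
  & (0 < k)%N -> forall w, ~ D w -> forall r, [/\ avg k r w (xopt k r w) <= avg k r w y,
      `|dev k r (x k w) w| < delta & `|dev k r y w| < delta]].
  case: (posnP k) => [->|k0].
    exists set0; split => //; rewrite measure0 lee_fin mulr_ge0// ?invr_ge0 ?exprn_ge0//.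
    by rewrite divr_ge0// ltW.
  have [D DP] := choice (fun r => exD1 k r k0).
  have mD r : measurable (D r) by have [] := DP r.
  exists (\bigcup_(r in [set` xpredT]) D r); split.
  - exact: measurable_finType_bigcup.
  - apply: (le_trans (@le_measure_finType_bigcup _ _ _ P _ xpredT D
      (fun r _ => mD r) _ (measurable_finType_bigcup (fun r _ => mD r))
      (@subset_refl _ _))).
    apply: (@le_trans _ _ (\sum_(r < nrep a) (alpha / 4 * (k%:R ^+ 2)^-1)%:E)%E).
      by apply: lee_sum => r _; have [] := DP r.
    rewrite sumEFin lee_fin sumr_const card_ord.
    have c0 : 0 <= alpha / 4 * (k%:R ^+ 2)^-1.
      by rewrite mulr_ge0 ?invr_ge0 ?exprn_ge0// divr_ge0// ltW.
    by case: (a) => /=; rewrite -[leLHS]mulr_natl; lra.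
  - move=> _ w nD r; have [_ _] := DP r; apply => // Dr.
    by apply: nD; exists r.
have [D DP] := choice exD.
have mD k : measurable (D k) by have [] := DP k.
set S := [set w | _].
have mS : measurable S.
  rewrite (_ : S = \bigcup_k ([set w | stop k w]
      `&` (\bigcap_(j in [set j | (j < k)%N]) ~` [set w | stop j w])
      `&` [set w | (0 < k)%N /\ opt_gap X f mu (x k w) <= h * Num.sqrt (sv k w) + eps])).
    apply: bigcupT_measurable => k; apply: measurableI; first apply: measurableI => //.
      by apply: bigcap_measurableType => j _; exact: measurableC.
    case: (posnP k) => [->|k0].
      by rewrite (_ : mkset _ = set0)//; apply/seteqP; split => // w [].
    rewrite (_ : mkset _ =
        [set w | opt_gap X f mu (x k w) <= h * Num.sqrt (sv k w) + eps]).
      apply: measurable_le; last exact: measurable_threshold.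
      apply: measurable_funB => //.
      apply: (measurable_Ef_comp f_meas f_cont f_bnd X0 cX mu_supp).
        by have [] := x_rv k0.
      by move=> w; exact: Xk.
    by apply/seteqP; split => w; [case|move=> ?; split].
  apply/seteqP; split => w.
    move=> [k /stopping_time_eq[sk kmin] gk]; exists k => //; split.
      by split => // j /= jk; exact: kmin.
    by split => //; case: sk.
  move=> [k _ [[sk kmin] [_ gk]]]; by exists k => //; apply/stopping_time_eq.
have mUD : measurable (\bigcup_k D k) by exact: bigcupT_measurable.
have nS : (P (~` S) <= alpha%:E)%E.
  have nW0 : P (~` W) = 0%E.
    have := probability_setC P measurable_W.
    by rewrite (terminates e0) subee.
  apply: (@le_trans _ _ (P (~` W `|` \bigcup_k D k))).
    apply: le_measure; rewrite ?inE; first exact: measurableC.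
      by apply: measurableU => //; exact: measurableC.
    move=> w nSw; apply: contrapT => /not_orP[/contrapT Ww nD]; apply: nSw.
    have [k [sk kmin]] := first_stop Ww.
    exists k; first exact/stopping_time_eq.
    have [k0 gk] := sk.
    have [_ _ /(_ k0 w) Dk] := DP k.
    have {}Dk r := Dk (fun Dkw => nD (ex_intro2 _ _ k Logic.I Dkw)) r.
    have := @GAP_ge _ _ _ X f mu s a (n k) (fun r i => xi k r i w) (x k w)
      (fun r => xopt k r w) delta y Xy (fun r => let: And3 h _ _ := Dk r in h)
      (fun r => let: And3 _ h _ := Dk r in h) (fun r => let: And3 _ _ h := Dk r in h).
    rewrite -/(gap k w) => gapk.
    have : h' * Num.sqrt (sv k w) <= h * Num.sqrt (sv k w).
      by rewrite ler_wpM2r ?sqrtr_ge0.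
    by rewrite /delta in gapk; lra.
  apply: (le_trans (measureU2 _ (measurableC measurable_W) mUD)).
  rewrite [X in (X + _)%E]nW0 add0e.
  apply: (le_trans (measure_sigma_subadditive P mD mUD (@subset_refl _ _))).
  apply: (@le_trans _ _ (\sum_(k <oo) (alpha / 2 * (k%:R ^+ 2)^-1)%:E)%E).
    by apply: lee_nneseries => // k _; have [] := DP k.
  have al20 : 0 <= alpha / 2 by rewrite divr_ge0// ltW.
  by rewrite (le_trans (nneseries_inv_squares al20))// lee_fin; lra.
have := probability_setC P mS; move: nS => /[swap] ->.
by rewrite leeBlDr ?fin_num_measure// -leeBlDl// -EFinB.
Qed.

End procedure.

(** * Sample sizes and the theorem *)

Section sample_sizes.
Context (R : realType) (s : method) (a : assessment) (n : nat -> nat) (L p c : R).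
Hypothesis L0 : 0 < L.
Hypothesis p0 : 0 < p.
Hypothesis c1 : 1 <= c.
Hypothesis n_div : forall k, (0 < k)%N -> (points_per_obs s * nrep a %| n k)%N.
Hypothesis n_large : forall k, (0 < k)%N ->
  L * (c + 2 * p * ln k%:R ^+ 2) <= (n k)%:R / (points_per_obs s)%:R.

(** The factor 2 accounts for the two replications that may share the sample. *)
Lemma nobs_ge k : (0 < k)%N ->
  L / 2 * (1 + 2 * p * ln k%:R ^+ 2) <= (nobs s a (n k))%:R.
Proof.
move=> k0; have := n_large k0; have /dvdnP[q ->] := n_div k0.
have -> : nobs s a (q * (points_per_obs s * nrep a)) = q.
  by rewrite /nobs /rep_size mulnA !mulnK//; [case: (s)|case: (a)].
rewrite mulnA (mulnC q) -mulnA mulnC natrM.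
have pt : (points_per_obs s)%:R != 0 :> R by rewrite pnatr_eq0; case: (s).
rewrite mulfK// natrM => h.
have : (nrep a)%:R <= 2 :> R by rewrite ler_nat; case: (a).
have : 0 <= q%:R :> R by [].
move: h; set t := ln _ ^+ 2 => h q0 a2.
have h1 : L * (1 + 2 * p * t) <= L * (c + 2 * p * t) by rewrite ler_pM2l// lerD2r.
have h2 : q%:R * (nrep a)%:R <= q%:R * 2 :> R by rewrite ler_wpM2l.
lra.
Qed.

Lemma nobs_grows M : exists K, forall k, (K <= k)%N -> (0 < k)%N ->
  (M <= nobs s a (n k))%N.
Proof.
pose t : R := M%:R / (L * p) + 1.
have Lp : 0 < L * p by exact: mulr_gt0.
have t1 : 1 <= t by rewrite lerDr divr_ge0// ltW.
exists (Num.truncn (expR t)).+1 => k Kk k0; rewrite -(ler_nat R).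
apply: le_trans (nobs_ge k0).
have tk : t <= ln k%:R.
  rewrite -ler_expR lnK ?posrE ?ltr0n//.
  by rewrite ltW// (lt_le_trans (truncnS_gt _))// ler_nat.
have : t * 1 <= ln k%:R ^+ 2.
  by rewrite expr2 ler_pM//; [exact: le_trans t1|exact: le_trans tk].
rewrite mulr1 -(ler_pM2l Lp) {1}/t mulrDr mulrCA mulfV ?mulr1; last by rewrite gt_eqF.
have := L0; lra.
Qed.

End sample_sizes.

Theorem theorem1 (R : realType) (d : measure_display)
    (Omega : measurableType d) (P : probability Omega R) (dx dxi : nat)
    (X : set 'rV[R]_dx) (f : 'rV[R]_dx -> 'rV[R]_dxi -> R)
    (mu : probability 'rV[R]_dxi R) (s : method) (a : assessment)
    (x : nat -> Omega -> 'rV[R]_dx)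
    (h' eps eps' p alpha : R)
    (n : R -> nat -> nat)
    (xi : R -> nat -> 'I_(nrep a) -> nat -> Omega -> 'rV[R]_dxi)
    (xopt : R -> nat -> 'I_(nrep a) -> Omega -> 'rV[R]_dx)
    (f_meas : measurable_fun (X `*` msupport mu) (fun z => f z.1 z.2))
    (HSP : A_SP X f mu)
    (x_rv : forall k, (0 < k)%N ->
       measurable_fun setT (x k) /\ forall w, X (x k w))
    (HA1 : {ae P, forall w, exists2 y, Xstar X f mu y & cluster (x^~ w @ \oo) y})
    (HA2 : s = LatinHypercube -> A2_LHS P mu f X)
    (h'_gt0 : 0 < h') (eps'_gt0 : 0 < eps') (eps'_lt : eps' < eps)
    (p_gt0 : 0 < p) (alpha01 : 0 < alpha < 1)
    (n_mono : forall h, h' < h ->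
       n h 0%N = 2%N /\ forall k, (n h k <= n h k.+1)%N)
    (n_div : forall h k, h' < h -> (0 < k)%N ->
       (points_per_obs s * nrep a %| n h k)%N)
    (n_defined : forall h k, h' < h -> (0 < k)%N -> (2 <= nobs s a (n h k))%N)
    (n_large : forall h k, h' < h -> (0 < k)%N ->
       (h - h')^-1 ^+ 2 * (c_p p alpha + 2 * p * ln k%:R ^+ 2)
         <= (n h k)%:R / (points_per_obs s)%:R)
    (Hsampling : forall h, h' < h -> sampling P mu s (n h) x (xi h))
    (xopt_rv : forall h k r, h' < h -> (0 < k)%N ->
       measurable_fun setT (xopt h k r) /\ forall w, X (xopt h k r w))
    (xopt_opt : forall h k r, h' < h -> (0 < k)%N ->
       {ae P, forall w, forall y, X y ->
         let avg := sample_avg (nobs s a (n h k))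
                      (obs f s (fun i => xi h k r i w)) in
         avg (xopt h k r w) <= avg y}) :
  let gap h k w :=
    GAP f s (n h k) (fun r i => xi h k r i w) (x k w)
      (fun r => xopt h k r w) in
  let sv h k w :=
    SV f s (n h k) (fun r i => xi h k r i w) (x k w)
      (fun r => xopt h k r w) in
  let T h := stopping_time h' eps' (gap h) (sv h) in
  (forall h, h' < h -> P [set w | (T h w < +oo)%E] = 1%E) /\
  ((1 - alpha)%:E <=
    limf_einf (fun h => P [set w | exists2 k : nat, T h w = k%:R%:E &
        opt_gap X f mu (x k w) <= h * Num.sqrt (sv h k w) + eps]%R)
      h'^'+)%E.
Proof.
move=> gap sv T.
have [f_cont [C [C0 f_bnd]] [X0 cX] [indep invF]] := HSP.
have cp1 : 1 <= c_p p alpha by rewrite /c_p le_max lexx orbT.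
have L0 h : h' < h -> 0 < (h - h')^-1 ^+ 2.
  by move=> hh; rewrite exprn_gt0// invr_gt0 subr_gt0.
have large h hh k := @nobs_ge R s a (n h) _ p _ (L0 h hh) cp1
  (fun k => n_div h k hh) (fun k => n_large h k hh) k.
have grows h hh := nobs_grows (L0 h hh) p_gt0 cp1
  (fun k => n_div h k hh) (fun k => n_large h k hh).
split=> [h hh|].
  rewrite (_ : mkset _ = [set w | exists k, stops h' eps' (gap h) (sv h) k w]).
    exact: (terminates C0 f_meas f_cont f_bnd X0 cX invF indep (Hsampling h hh) HA2
      x_rv HA1 (fun k => n_defined h k hh) (grows h hh)
      (fun k r => xopt_rv h k r hh) h'_gt0 eps'_gt0).
  by apply/seteqP; split => w /stopping_time_finite.
have [al0 al1] := andP alpha01.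
set b := rate (2 * C) ((eps - eps') / 4).
have b0 : 0 < b.
  by apply: rate_gt0; [rewrite mulr_gt0|rewrite divr_gt0// subr_gt0].
(* the exponent e below must exceed A0 for exp_log_sq_bound to apply and for
   expR (- (e / 2)) to be at most alpha / 24; it does when (h - h')^-2 >= L *)
pose A0 := 2 + p^-1 + 48 / alpha.
have pV : 0 < p^-1 by rewrite invr_gt0.
have alV : 0 < 48 / alpha by rewrite divr_gt0.
have A0p : 0 < A0 by rewrite /A0; lra.
have pA : p^-1 <= A0 by rewrite /A0; lra.
have A2 : 2 <= A0 by rewrite /A0; lra.
have alA : 48 / alpha <= A0 by rewrite /A0; lra.
pose L := 2 * A0 / b.
have Lp : 0 < L by rewrite divr_gt0// mulr_gt0.
rewrite limf_einfE.
apply: (@le_trans _ _ (ereal_inf ((fun h => P [set w | exists2 k : nat, T h w = k%:R%:E &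
        opt_gap X f mu (x k w) <= h * Num.sqrt (sv h k w) + eps]%R) @`
    [set h | h' < h /\ h < h' + (L + 1)^-1]))); last first.
  apply: ereal_sup_ubound; exists [set h | h' < h /\ h < h' + (L + 1)^-1] => //.
  apply: filterI; first exact: nbhs_right_gt.
  by apply: nbhs_right_lt; rewrite ltrDl invr_gt0 addr_gt0.
apply: le_ereal_inf_tmp => _ [h [hh hL] <-].
apply: (coverage C0 f_meas f_cont f_bnd X0 cX invF indep (Hsampling h hh) HA2
      x_rv HA1 (fun k => n_defined h k hh) (grows h hh)
      (fun k r => xopt_rv h k r hh) (fun k r => xopt_opt h k r hh) h'_gt0 eps'_gt0 eps'_lt
      (ltW hh) al0) => k k0.
have LhL : L <= (h - h')^-1 ^+ 2.
  have hd : h - h' <= (L + 1)^-1 by rewrite ltW// ltrBlDl.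
  have L1 : 0 < L + 1 by rewrite addr_gt0.
  have hh0 : 0 < h - h' by rewrite subr_gt0.
  have hL1 : L + 1 <= (h - h')^-1.
    by rewrite -[leLHS]invrK lef_pV2// posrE invr_gt0.
  have : (L + 1) * 1 <= (h - h')^-1 ^+ 2 by rewrite expr2 ler_pM//; lra.
  lra.
pose e := b * ((h - h')^-1 ^+ 2 / 2).
have eA : A0 <= e.
  rewrite /e mulrA ler_pdivlMr// mulrC (le_trans _ (ler_wpM2l (ltW b0) LhL))//.
  by rewrite /L mulrCA mulfV ?mulr1// gt_eqF.
have ep : 1 <= 2 * (e * p).
  have : p^-1 * p <= e * p.
    by rewrite ler_pM2r//; exact: le_trans pA eA.
  by rewrite mulVf ?gt_eqF//; lra.
have e2 : 2 <= e by exact: le_trans A2 eA.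
apply: (@le_trans _ _ (expR (- (e * (1 + 2 * p * ln k%:R ^+ 2))))).
  by rewrite ler_expR lerN2 /e -mulrA ler_pM2l// large.
apply: (le_trans (exp_log_sq_bound k0 e2 p_gt0 ep)).
rewrite ler_wpM2r ?invr_ge0 ?exprn_ge0//.
rewrite expRN -[leRHS]invrK lef_pV2 ?posrE ?expR_gt0 ?invr_gt0 ?divr_gt0//.
rewrite invf_div (le_trans _ (expR_ge1Dx _))//.
have : 48 / alpha <= e by exact: le_trans alA eA.
rewrite (_ : 48 / alpha = 2 * (24 / alpha)); last by rewrite mulrA; congr (_ / _); ring.
lra.
Qed.
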